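(* Let $d\ge1$, let $n\ge3$ be odd, and let $\mathbf{Y}=\mathbf{Y}^{(\mathbf{0})}$ be the smoothing process on $\mathbb{T}_n^d=(\mathbb{Z}/n\mathbb{Z})^d$ associated with simple random walk, started from unit mass at $\mathbf{0}$ and zero mass elsewhere. Then for any $u\ge0$, $$\mathbb{E}\sum_{\mathbf{i}\in\mathbb{T}_n^d}\Delta_{\mathbf{i}}^2(u)=\sum_{k=1}^\infty G^{\star k}(u),$$ with $\Delta_{\mathbf{i}}(u)$ and $G$ as defined in the context.
   Context: Vertices $\mathbf{i},\mathbf{j}\in\mathbb{T}_n^d$ are neighbors ($\mathbf{i}\sim\mathbf{j}$) if they differ by $\pm1$ (mod $n$) in exactly one coordinate and agree in the others. Smoothing process on $\mathbb{T}_n^d$: each site carries a unit-intensity Poisson process (clock); all clocks are jointly independent and independent of $\mathbf{Y}(0)$. When the clock at $\mathbf{k}$ rings at time $t$, the value at $\mathbf{k}$ becomes $Y_{\mathbf{k}}(t)=\frac{1}{2d}\sum_{\mathbf{j}\sim\mathbf{k}}Y_{\mathbf{j}}(t-)$ and all other values remain unchanged. Set $\Delta_{\mathbf{i}}(t)=\frac{1}{2d}\sum_{\mathbf{j}\sim\mathbf{i}}Y_{\mathbf{j}}(t)-Y_{\mathbf{i}}(t)$. For $F:\mathbb{R}_+\times\mathbb{T}_n^d\to\mathbb{R}$ let $(\Delta F)(t,\mathbf{i})=\frac{1}{2d}\sum_{\mathbf{j}\sim\mathbf{i}}F(t,\mathbf{j})-F(t,\mathbf{i})$. Let $p(t,\mathbf{i})$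 be the heat kernel of the continuous-time (rate 1) simple random walk on $\mathbb{T}_n^d$ started at $\mathbf{0}$, i.e. the solution of $\partial_tp=\Delta p$ with $p(0,\mathbf{i})=\mathbf{1}_{\{\mathbf{i}=\mathbf{0}\}}$, and let $G(t)=\sum_{\mathbf{i}\in\mathbb{T}_n^d}(\Delta p(t,\mathbf{i}))^2$, $t\ge0$. $(f\star g)(u)=\int_0^uf(u-s)g(s)\,ds$; $G^{\star k}$ is the $k$-fold convolution of $G$ with itself ($G^{\star1}=G$). *)

(* Defs.v *)
From HB Require Import structures.
From mathcomp Require Import all_boot all_order all_algebra finmap.
From mathcomp Require Import all_classical all_reals all_analysis.

Set Implicit Arguments.
Unset Strict Implicit.
Unset Printing Implicit Defensive.

Import Order.TTheory GRing.Theory Num.Theory.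
Import numFieldNormedType.Exports.

Local Open Scope classical_set_scope.
Local Open Scope ring_scope.

(* ['Z_n] is Z/nZ only for [1 < n]. *)
Notation torus d n := {ffun 'I_d -> 'Z_n}.

Definition neighbor (d n : nat) (i j : torus d n) : bool :=
  [exists c, ((j c == i c + 1) || (j c == i c - 1)) &&
             [forall c', (c' != c) ==> (j c' == i c')]].

Definition neighbor_mean (R : realType) (d n : nat) (f : torus d n -> R)
    (i : torus d n) : R :=
  (2 * d)%:R^-1 * \sum_(j | neighbor i j) f j.

Definition laplacian (R : realType) (d n : nat) (f : torus d n -> R)
    (i : torus d n) : R :=
  neighbor_mean f i - f i.

Section Independence.
Context (R : realType) (disp : measure_display) (T : measurableType disp).
Context (P : probability T R).

Definition mutual_independence (I : choiceType) (F : I -> set (set T)) : Prop :=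
  forall (J : {fset I}) (A : I -> set T),
    (forall i, i \in J -> F i (A i)) ->
    P (\bigcap_(i in [set` J]) A i) = (\prod_(i <- J) P (A i))%E.

Definition sigma_family (disp' : measure_display) (U : measurableType disp')
    (I : Type) (D : set I) (X : I -> T -> U) : set (set T) :=
  <<s \bigcup_(i in D) preimage_set_system setT (X i) measurable >>.

End Independence.

(* Time is the half-line [0 <= t]; values at negative times are irrelevant. *)
Section SmoothingProcess.
Context (R : realType) (disp : measure_display) (T : measurableType disp).
Context (P : probability T R).

Definition counting_path (N : R -> nat) : Prop :=
  [/\ N 0 = 0%N,
      forall s t, 0 <= s -> s <= t -> (N s <= N t)%N
    & forall t, 0 <= t -> \forall s \near t^'+, N s = N t].

(* The truncated subtraction is harmless: paths are a.s. nondecreasing. *)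
Definition unit_poisson_process (N : R -> {RV P >-> nat}) : Prop :=
  [/\ {ae P, forall w, counting_path (fun t => N t w)},
      forall (s t : R) (k : nat), 0 <= s -> s < t ->
        P [set w | (N t w - N s w)%N = k] = (poisson_pmf (t - s) k)%:E
    & forall t : nat -> R, 0 <= t 0%N -> nondecreasing_seq t ->
        mutual_independence P (fun m : nat =>
          preimage_set_system setT
            (fun w => (N (t m.+1) w - N (t m) w)%N) measurable)].

Definition rings (N : R -> nat) (t : R) : Prop :=
  0 < t /\ \forall s \near t^'-, (N s < N t)%N.

(* Simultaneous rings, a null event for independent clocks, would all use the
   left limits. *)
Definition smoothing_path (d n : nat) (N : torus d n -> R -> nat)
    (Y : R -> torus d n -> R) : Prop :=
  (forall t k, rings (N k) t ->
     Y t k = neighbor_mean (fun j => lim (Y s j @[s --> t^'-])) k) /\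
  (forall s t k, 0 <= s -> s <= t ->
     (forall r, s < r -> r <= t -> ~ rings (N k) r) -> Y t k = Y s k).

Record smoothing_process (d n : nat) (N : torus d n -> R -> {RV P >-> nat})
    (Y : R -> torus d n -> {RV P >-> R}) : Prop := SmoothingProcess {
  smoothing_clocks : forall k, unit_poisson_process (N k) ;
  (* [None] stands for the initial configuration, [Some k] for the clock at
     [k]. *)
  smoothing_indep : mutual_independence P (fun x : option (torus d n) =>
    if x is Some k
    then sigma_family [set t : R | 0 <= t] (fun t => N k t : T -> nat)
    else sigma_family [set: torus d n] (fun i => Y 0 i : T -> R)) ;
  smoothing_dynamics : {ae P, forall w,
    smoothing_path (fun k t => N k t w) (fun t i => Y t i w)} }.

End SmoothingProcess.

Definition heat_kernel (R : realType) (d n : nat) (p : R -> torus d n -> R)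
    : Prop :=
  [/\ forall i, p 0 i = (i == 0)%:R,
      forall i, p t i @[t --> 0^'+] --> p 0 i
    & forall (t : R) i, 0 < t ->
        is_derive t 1 (fun s => p s i) (laplacian (p t) i)].

Definition heat_energy (R : realType) (d n : nat) (p : R -> torus d n -> R) (t : R)
    : R :=
  \sum_i laplacian (p t) i ^+ 2.

Definition convolution (R : realType) (f g : R -> R) (u : R) : R :=
  \int[lebesgue_measure]_(s in `[0, u]) (f (u - s) * g s).

(* The [k]-fold convolution for [1 <= k]; the value at [k = 0] is unused. *)
Definition conv_power (R : realType) (f : R -> R) (k : nat) : R -> R :=
  iter k.-1 (convolution f) f.

(* Main.v *)
Require Import Defs.
From HB Require Import structures.
From mathcomp Require Import all_boot all_order all_algebra finmap.
From mathcomp Require Import all_classical all_reals all_analysis.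
From mathcomp Require Import measurable_realfun.
From mathcomp Require Import ring lra.

Set Implicit Arguments.
Unset Strict Implicit.
Unset Printing Implicit Defensive.

Import Order.TTheory GRing.Theory Num.Theory.
Import numFieldNormedType.Exports.

Local Open Scope classical_set_scope.
Local Open Scope ring_scope.

(** Write [C j k t] for the second moments E[Y_j(t) Y_k(t)], Delta_k for the
    Laplacian of the configuration at [k], and H(t) for the expected sum of the
    squares of the Delta_k at time [t].

    A ring at [k] adds Delta_k to the value at [k]. Hence the generator of the
    process sends the monomial y_j y_k to its Laplacian in [j], plus its
    Laplacian in [k], plus Delta_j^2 when [j = k]: the second moments solve a
    linear heat equation in two variables whose source sits on the diagonal and
    has total mass H(t) ([pair_moment_derive], [moment_rateE]).

    Fix [u] and let the configuration of time [s] be smoothed by the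
    deterministic heat flow for the remaining time [u - s]. The expected sum of
    the squared Laplacians of the result ([duhamel_energy]) is G(u) at [s = 0]
    and H(u) at [s = u]. Since the Laplacian is self-adjoint and commutes with
    the symmetries of the torus, the flow cancels the drift of the second
    moments and only the source contributes to the derivative in [s], which is
    G(u - s) H(s) ([duhamel_energy_derive]). Integrating gives the renewal
    equation H = G + G * H, where the product is convolution
    ([laplacian_energy_renewal]). Substituting it into itself leaves after [k]
    rounds a remainder of order A^k u^k / k!, where A bounds G on [0, u], so the
    iterated convolutions sum to H ([renewal_series_cvg]).

    The differential equation for the moments is reached without stochastic
    calculus. Along a time grid, outside an event of probability at most the sum
    of the (M h)^2 over the intervals, with [M] the number of sites and [h] the
    length of the interval, every interval carries at most one ring of all the
    clocks together. Then the configuration is a function of the word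
    of ringing sites, and the probability of a word is a product of Poisson
    weights. Expectations thus become sums over words ([grid_approximation]).
    Comparing a fine grid of [0, s] with the same grid followed by one interval
    of length [h], and refining, gives the expansion of the moments on [s, s + h]
    with an error of order h^2 uniformly in [s] ([one_step_estimate]). *)

(** * Neighbours on the torus and the averaging move *)

Section TorusGraph.
Variables d n : nat.
Implicit Types i j k a : torus d n.

Lemma neighbor_sym i j : neighbor i j = neighbor j i.
Proof.
suff sub (x y : torus d n) : neighbor x y -> neighbor y x by apply/idP/idP; exact: sub.
rewrite /neighbor => /existsP -[c /andP[h /forallP hc]]; apply/existsP; exists c.
apply/andP; split.
  by case/orP: h => /eqP ->; rewrite ?addrK ?subrK eqxx ?orbT.
by apply/forallP => c'; apply/implyP => /(implyP (hc c')) /eqP ->.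
Qed.

Lemma neighbor_irrefl i : neighbor i i = false.
Proof.
rewrite /neighbor; apply/existsP => -[c /andP[+ _]].
have h x y : (x == x + y :> 'Z_n) = (y == 0).
  by rewrite -{1}[x]addr0 (inj_eq (addrI x)) eq_sym.
by rewrite !h oppr_eq0 oner_eq0.
Qed.

Lemma neighbor_translate a i j : neighbor (i + a) (j + a) = neighbor i j.
Proof.
rewrite /neighbor; apply: eq_existsb => c; rewrite !ffunE; congr andb.
  by rewrite !(addrAC (i c) (a c)) !(inj_eq (addIr (a c))).
by apply: eq_forallb => c'; rewrite !ffunE (inj_eq (addIr _)).
Qed.

Lemma neighbor_opp i j : neighbor (- i) (- j) = neighbor i j.
Proof.
rewrite /neighbor; apply: eq_existsb => c; rewrite !ffunE orbC; congr andb.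
  by rewrite !eqr_oppLR !opprD !opprK.
by apply: eq_forallb => c'; rewrite !ffunE eqr_opp.
Qed.

(** The [2 * d] moves along the axes reach every neighbour, possibly twice; the
    inequality is what keeps averages of values of the unit interval in it. *)
Lemma card_neighbor i : (#|neighbor i| <= 2 * d)%N.
Proof.
pose e (x : bool * 'I_d) : torus d n :=
  [ffun c' => if c' == x.2 then (if x.1 then i c' + 1 else i c' - 1) else i c'].
have -> : (2 * d = #|{: bool * 'I_d}|)%N by rewrite card_prod card_bool card_ord.
apply: leq_trans (leq_image_card e _); apply: subset_leq_card.
apply/fintype.subsetP => j; rewrite unfold_in /neighbor.
move=> /existsP -[c /andP[h /forallP hc]].
have jE b : j c = (if b then i c + 1 else i c - 1) -> j = e (b, c).
  move=> jc; apply/ffunP => c'; rewrite !ffunE /=.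
  by case: eqP => [->//|/eqP /(implyP (hc c'))/eqP].
by case/orP: h => /eqP h; apply/fintype.imageP;
  [exists (true, c)|exists (false, c)] => //; exact: jE.
Qed.

End TorusGraph.

Section Averaging.
Variables (R : realType) (d n : nat).
Implicit Types (i j k : torus d n) (y : torus d n -> R) (o : option (torus d n)).

Definition average_at y k : torus d n -> R :=
  fun i => if i == k then neighbor_mean y k else y i.

(** The effect of a time interval with at most one ring: [None] when no clock
    rings, [Some k] for a single ring at [k]. *)
Definition step y o := if o is Some k then average_at y k else y.

Lemma eq_neighbor_mean y y' i : y =1 y' -> neighbor_mean y i = neighbor_mean y' i.
Proof. by move=> yy'; rewrite /neighbor_mean; congr (_ * _); apply: eq_bigr. Qed.

Lemma neighbor_mean01 y i : (forall j, 0 <= y j <= 1) -> 0 <= neighbor_mean y i <= 1.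
Proof.
move=> y01; apply/andP; split.
  by rewrite mulr_ge0// sumr_ge0// => j _; case/andP: (y01 j).
case: d y i y01 => [|d'] y i y01.
  by rewrite /neighbor_mean muln0 invr0 mul0r.
rewrite /neighbor_mean ler_pdivrMl ?ltr0n// mulr1.
apply: (@le_trans _ _ (\sum_(j | neighbor i j) 1)).
  by apply: ler_sum => j _; case/andP: (y01 j).
by rewrite sumr_const ler_nat card_neighbor.
Qed.

Lemma step01 y o : (forall j, 0 <= y j <= 1) -> forall i, 0 <= step y o i <= 1.
Proof.
case: o => [k|]//= y01 i; rewrite /average_at; case: eqP => // _.
exact: neighbor_mean01.
Qed.

End Averaging.

(** * Paths of the clocks and of the configuration *)

Section Clock.
Variables (R : realType) (N : R -> nat) (a b : R).
Hypotheses (cN : counting_path N) (a0 : 0 <= a).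

Lemma flat_no_ring (r : R) : N a = N b -> a < r -> r <= b -> ~ rings N r.
Proof.
case: cN => _ mN _ Nab ar rb [r0 ringr].
have [s [/= Nsr sa]] := @filter_ex _ _ (at_left_proper_filter r) _
  (filterI ringr (nbhs_left_gt ar)).
have := leq_trans Nsr (mN _ _ (le_trans a0 (ltW ar)) rb).
by rewrite -Nab ltnNge mN// ltW.
Qed.

(** The ring is at the infimum of the times where the count has increased:
    right continuity makes the jump take place at the infimum itself. *)
Lemma single_ring : a < b -> N b = (N a).+1 ->
  exists r : R, [/\ a < r, r <= b, rings N r, N r = N b &
    forall s : R, a <= s -> s < r -> N s = N a].
Proof.
case: cN => _ mN rcN ab Nab.
pose S := [set s : R | a <= s <= b /\ (N a < N s)%N].
have Sb : S b by rewrite /S /= lexx (ltW ab) Nab.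
have lbS : lbound S a by move=> s [/andP[]].
have infS : has_inf S by split; [exists b|exists a].
have ar : a <= inf S by apply: lb_le_inf => //; exists b.
have rb : inf S <= b by apply: ge_inf => //; exists a.
have r0 := le_trans a0 ar.
have before (s : R) : a <= s -> s < inf S -> N s = N a.
  move=> as_ sr; apply/eqP; rewrite eqn_leq andbC mN//= leqNgt; apply/negP => NaNs.
  suff : inf S <= s by rewrite leNgt sr.
  apply: ge_inf; first by exists a.
  by split; rewrite ?as_//= (le_trans (ltW sr)).
have Nr : N (inf S) = N b.
  have [s [/= sN sr]] := @filter_ex _ _ (at_right_proper_filter (inf S)) _
    (filterI (rcN _ r0) (nbhs_right_gt (inf S))).
  have : (N a < N (inf S))%N.
    rewrite -sN; have e0 : 0 < s - inf S by rewrite subr_gt0.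
    have [s' [/andP[as' _] Ns'] s'lt] := inf_adherent e0 infS.
    apply: leq_trans Ns' (mN _ _ (le_trans a0 as') _).
    by rewrite ltW// (lt_le_trans s'lt)// subrKC.
  rewrite Nab => h; by apply/eqP; rewrite eqn_leq h andbT -Nab mN.
have ar' : a < inf S.
  rewrite lt_neqAle ar andbT; apply/eqP => ra.
  by move: Nr; rewrite -ra Nab => /esym /eqP; rewrite -[_ == _]negbK neq_ltn ltnSn orbT.
exists (inf S); split => //; split; first exact: le_lt_trans ar'.
near=> s.
have as_ : a <= s by near: s; exact: nbhs_left_ge.
have sr : s < inf S by near: s; exact: nbhs_left_lt.
by rewrite before// Nr Nab.
Unshelve. all: by end_near. Qed.

End Clock.

Section PathStep.
Variables (R : realType) (d n : nat) (N : torus d n -> R -> nat).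
Variable (Y : R -> torus d n -> R).
Hypotheses (cN : forall k, counting_path (N k)) (sY : smoothing_path N Y).

(** Until the ring, all values are those of time [a]; as no site is its own
    neighbour, the left limits entering the average at the ring are the values
    at time [a] as well. *)
Lemma smoothing_path_step (a b : R) (o : option (torus d n)) : 0 <= a -> a < b ->
  (forall k, (N k b - N k a)%N = (o == Some k)) -> Y b =1 step (Y a) o.
Proof.
move=> a0 ab incr; have [sYr sYc] := sY.
have mN k (s t : R) : 0 <= s -> s <= t -> (N k s <= N k t)%N.
  by case: (cN k) => _ + _; apply.
have Nba k : N k b = (N k a + (o == Some k))%N by rewrite -incr subnKC// mN// ltW.
have still k (t : R) : o != Some k -> a <= t -> t <= b -> Y t k = Y a k.
  move=> ok at_ tb; apply: sYc => // r ar rt.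
  apply: (@flat_no_ring _ _ a b) => //; last exact: le_trans tb.
  by rewrite Nba (negPf ok) addn0.
move=> i; case: o incr Nba still => [k|] _ Nba still /=; last by rewrite still// ltW.
rewrite /average_at; case: eqP => [->|/eqP ik]; last first.
  by rewrite still ?(ltW ab)//; apply: contra ik => /eqP [->].
have [|r [ar rb ringr Nr _]] := single_ring (cN k) a0 ab.
  by rewrite Nba eqxx addn1.
have r0 : 0 <= r by rewrite (le_trans a0)// ltW.
have -> : Y b k = Y r k.
  by apply: sYc => // t rt tb; exact: (@flat_no_ring _ _ r b).
rewrite sYr// /neighbor_mean; congr (_ * _); apply: eq_bigr => j kj.
apply: lim_near_cst; first exact: Rhausdorff.
near=> s; apply: still.
- by apply: contraTneq kj => -[->]; rewrite neighbor_irrefl.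
- by near: s; exact: nbhs_left_ge.
- by apply: le_trans rb; near: s; exact: nbhs_left_le.
Unshelve. all: by end_near. Qed.

Lemma smoothing_path_grid (tau : nat -> R) (w : seq (option (torus d n))) :
  tau 0%N = 0 -> (forall l, tau l < tau l.+1) ->
  (forall l k, (l < size w)%N ->
    (N k (tau l.+1) - N k (tau l))%N = (nth None w l == Some k)) ->
  Y (tau (size w)) =1 foldl (@step R d n) (Y 0) w.
Proof.
move=> tau0 tauS; have tau_ge0 l : 0 <= tau l.
  by elim: l => [|l IH]; rewrite ?tau0// (le_trans IH)// ltW.
elim/last_ind: w => [|w o IH] incr; first by rewrite /= tau0.
rewrite size_rcons foldl_rcons => i.
have -> : foldl (@step R d n) (Y 0) w = Y (tau (size w)).
  apply/funext => j; rewrite IH// => l k lw.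
  by rewrite incr ?size_rcons ?leqW// nth_rcons lw.
apply: smoothing_path_step => // k.
by rewrite incr ?size_rcons// nth_rcons ltnn eqxx.
Qed.

End PathStep.

(** * Probability of a word of rings *)

Section Increments.
Variables (R : realType) (disp : measure_display) (T : measurableType disp).
Variable (P : probability T R).

Lemma mutual_independence_seq (I : choiceType) (F : I -> set (set T))
    (s : seq I) (A : I -> set T) :
  mutual_independence P F -> uniq s -> (forall i, i \in s -> F i (A i)) ->
  P (\bigcap_(i in [set` s]) A i) = (\prod_(i <- s) P (A i))%E.
Proof.
move=> indep us FA; have sE := seq_fsetE tt s.
rewrite [X in P X](_ : _ = \bigcap_(i in [set` seq_fset tt s]) A i); last first.
  by congr bigcap; apply/seteqP; split=> i /=; rewrite sE.
rewrite indep; last by move=> i; rewrite sE; exact: FA.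
by apply: perm_big; rewrite -[X in perm_eq _ X]undup_id// seq_fset_perm.
Qed.

(** The clocks are independent through their whole histories on the half-line;
    this puts the events on finitely many increments among those histories. *)
Lemma sigma_family_increments (N : R -> {RV P >-> nat}) (tau : nat -> R)
    (c : nat -> nat) m :
  (forall l, 0 <= tau l) ->
  sigma_family [set t : R | 0 <= t] (fun t => N t : T -> nat)
    (\bigcap_(l in [set` iota 0 m]) [set x | (N (tau l.+1) x - N (tau l) x)%N = c l]).
Proof.
move=> tau0; rewrite /sigma_family; set G := \bigcup_(_ in _) _.
suff : measurable (\bigcap_(l in [set` iota 0 m])
   [set x | (N (tau l.+1) x - N (tau l) x)%N = c l] : set (g_sigma_algebraType G)) by [].
have mN t a : 0 <= t -> measurable ([set x | N t x = a] : set (g_sigma_algebraType G)).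
  move=> t0; apply: sub_sigma_algebra; exists t => //; exists [set a] => //.
  by rewrite setTI.
apply: bigcap_measurableType => l _.
rewrite [X in measurable X](_ : _ =
   \bigcup_a \bigcup_(b in [set b | (b - a)%N = c l])
     ([set x | N (tau l) x = a] `&` [set x | N (tau l.+1) x = b])); last first.
  apply/seteqP; split=> x /=.
    by move=> h; exists (N (tau l) x) => //; exists (N (tau l.+1) x).
  by move=> [a _ [b /= <- [-> ->]]].
apply: bigcup_measurable => a _; apply: bigcup_measurable => b _.
by apply: measurableI; exact: mN.
Qed.

Lemma poisson_increments (N : R -> {RV P >-> nat}) (tau : nat -> R)
    (c : nat -> nat) m :
  unit_poisson_process N -> 0 <= tau 0%N -> (forall l, tau l < tau l.+1) ->
  P (\bigcap_(l in [set` iota 0 m]) [set x | (N (tau l.+1) x - N (tau l) x)%N = c l]) =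
  (\prod_(l < m) poisson_pmf (tau l.+1 - tau l) (c l))%:E.
Proof.
move=> [_ inc indep] tau0 tauS.
have taund : nondecreasing_seq tau by apply/nondecreasing_seqP => l; exact: ltW.
have tau_ge0 l : 0 <= tau l by exact: le_trans (taund 0%N l _).
rewrite (mutual_independence_seq (indep tau tau0 taund)) ?iota_uniq//; last first.
  by move=> l _; exists [set c l] => //; rewrite setTI.
transitivity (\prod_(l <- iota 0 m) (poisson_pmf (tau l.+1 - tau l) (c l))%:E)%E.
  by apply: eq_bigr => l _; exact: inc.
rewrite -(big_morph EFin EFinM erefl); congr EFin.
rewrite -(big_mkord xpredT (fun l => poisson_pmf (tau l.+1 - tau l) (c l))).
by rewrite /index_iota subn0.
Qed.

End Increments.

Section WordProbability.
Variables (R : realType) (disp : measure_display) (T : measurableType disp).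
Variables (P : probability T R) (d n : nat).
Variables (N : torus d n -> R -> {RV P >-> nat}) (Y : R -> torus d n -> {RV P >-> R}).
Hypothesis hY : smoothing_process N Y.
Variable tau : nat -> R.
Hypotheses (tau0 : tau 0%N = 0) (tauS : forall l, tau l < tau l.+1).
Implicit Type w : seq (option (torus d n)).

(** The letter of an interval names the site that rings once in it, if any; an
    interval with more than one ring is described by no letter. *)
Definition word_event w : set T := \bigcap_(k in [set: torus d n])
  \bigcap_(l in [set` iota 0 (size w)])
  [set x | (N k (tau l.+1) x - N k (tau l) x)%N = (nth None w l == Some k)].

Definition letter_weight (h : R) (o : option (torus d n)) : R :=
  \prod_k poisson_pmf h (o == Some k).

Definition word_weight w : R :=
  \prod_(l < size w) letter_weight (tau l.+1 - tau l) (nth None w l).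

Lemma tau_ge0 l : 0 <= tau l.
Proof. by elim: l => [|l IH]; rewrite ?tau0// (le_trans IH)// ltW. Qed.

Lemma measurable_word_event w : measurable (word_event w).
Proof.
apply: fin_bigcap_measurable => [|k _]; first exact: finite_finset.
apply: fin_bigcap_measurable => [|l _]; first exact: finite_seq.
rewrite [X in measurable X](_ : _ =
   \bigcup_a \bigcup_(b in [set b | (b - a)%N = (nth None w l == Some k)])
     ([set x | N k (tau l) x = a] `&` [set x | N k (tau l.+1) x = b])); last first.
  apply/seteqP; split=> x /=.
    by move=> h; exists (N k (tau l) x) => //; exists (N k (tau l.+1) x).
  by move=> [a _ [b /= <- [-> ->]]].
apply: bigcup_measurable => a _; apply: bigcup_measurable => b _.
by apply: measurableI; rewrite -[X in measurable X]setTI;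
  [apply: (measurable_funP (N k (tau l)) _ [set a])
  |apply: (measurable_funP (N k (tau l.+1)) _ [set b])].
Qed.

(** Independence of the clocks gives the product over the sites, independence of
    the increments of each clock the product over the intervals. *)
Lemma probability_word_event w : P (word_event w) = (word_weight w)%:E.
Proof.
pose A (x : option (torus d n)) : set T := if x is Some k then
  \bigcap_(l in [set` iota 0 (size w)])
  [set x | (N k (tau l.+1) x - N k (tau l) x)%N = (nth None w l == Some k)] else setT.
pose s := [seq Some k | k <- index_enum {: torus d n}].
rewrite [word_event w](_ : _ = \bigcap_(x in [set` s]) A x); last first.
  apply/seteqP; split=> x /=.
    by move=> h o /= /mapP[k _ ->]; exact: h.
  move=> h k _; apply: (h (Some k)).
  by rewrite /= mem_map ?mem_index_enum//; exact: Some_inj.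
rewrite (mutual_independence_seq (smoothing_indep hY)); last 2 first.
- by rewrite map_inj_uniq ?index_enum_uniq//; exact: Some_inj.
- by move=> o /mapP[k _ ->]; apply: sigma_family_increments; exact: tau_ge0.
rewrite big_map /word_weight exchange_big /=.
transitivity (\prod_k (\prod_(l < size w)
    poisson_pmf (tau l.+1 - tau l) (nth None w l == Some k))%:E)%E.
  apply: eq_bigr => k _; apply: poisson_increments => //; last by rewrite tau0.
  exact: smoothing_clocks hY k.
by rewrite -(big_morph EFin EFinM erefl).
Qed.

Lemma word_event_dynamics : {ae P, forall x, (forall w, word_event w x ->
  Y (tau (size w)) ^~ x =1 foldl (@step R d n) (Y 0 ^~ x) w)}.
Proof.
have cN : {ae P, forall x, forall k, counting_path (fun t => N k t x)}.
  by apply: filter_forall => k; have [] := smoothing_clocks hY k.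
apply: filterS2 cN (smoothing_dynamics hY) => x cN sY w wx.
apply: (smoothing_path_grid cN sY tau0 tauS) => l k lw.
by apply: wx => //=; rewrite mem_iota.
Qed.

End WordProbability.

(** * Total weight of the words *)

Section Words.
Variables (R : realType) (d n : nat).
Implicit Types (w : seq (option (torus d n))) (o : option (torus d n)).

(** Words grow at their end, so that one more interval of time is one more sum
    over its letter. *)
Fixpoint words (m : nat) : seq (seq (option (torus d n))) :=
  if m is m'.+1 then [seq rcons w o | w <- words m', o <- index_enum _]
  else [:: [::]].

Lemma size_words m w : w \in words m -> size w = m.
Proof.
elim: m w => [|m IH] w /=; first by rewrite inE => /eqP ->.
by move=> /allpairsP[[v o] /= [/IH vm _ ->]]; rewrite size_rcons vm.
Qed.

Lemma uniq_words m : uniq (words m).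
Proof.
elim: m => //= m IH; apply: allpairs_uniq => //; first exact: index_enum_uniq.
by move=> [v o] [v' o'] _ _ /= /rcons_inj.
Qed.

Lemma big_words_rcons m (F : _ -> R) : \sum_(w <- words m.+1) F w =
  \sum_(w <- words m) \sum_o F (rcons w o).
Proof. by rewrite /= big_allpairs_dep. Qed.

Notation M := #|{: torus d n}|.

Lemma letter_weight_None h : 0 < h -> @letter_weight R d n h None = expR (- (M%:R * h)).
Proof.
move=> h0; rewrite /letter_weight.
under eq_bigr do rewrite /poisson_pmf h0 expr0 fact0 invr1 !mul1r.
rewrite prodr_const -expRM_natl; congr expR.
by rewrite mulrN.
Qed.

Lemma letter_weight_Some h k : 0 < h ->
  @letter_weight R d n h (Some k) = h * expR (- (M%:R * h)).
Proof.
move=> h0; rewrite -(letter_weight_None h0) /letter_weight.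
rewrite (bigD1 k)//= [in RHS](bigD1 k)//= mulrA; congr (_ * _).
  by rewrite /poisson_pmf h0 eqxx expr1 expr0 fact0 factE !invr1 !mulr1 mul1r.
apply: eq_bigr => j jk.
by rewrite [Some k == _](_ : _ = false)//; apply/negbTE; apply: contra jk => /eqP[->].
Qed.

Lemma letter_weight_ge0 h o : 0 <= @letter_weight R d n h o.
Proof. by apply: prodr_ge0 => k _; exact: poisson_pmf_ge0. Qed.

Lemma sum_letter_weight (F : _ -> R) h : 0 < h -> \sum_o letter_weight h o * F o =
  expR (- (M%:R * h)) * (F None + h * \sum_(k : torus d n) F (Some k)).
Proof.
move=> h0; rewrite (bigD1 None)//= letter_weight_None// mulrDr; congr (_ + _).
rewrite (reindex_omap Some id) /=; last by case.
under eq_bigl do rewrite eqxx.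
rewrite !mulr_sumr; apply: eq_bigr => k _.
by rewrite letter_weight_Some//; ring.
Qed.

Lemma sum_letter_weight1 h : 0 < h ->
  \sum_o @letter_weight R d n h o = expR (- (M%:R * h)) * (1 + M%:R * h).
Proof.
move=> h0; under eq_bigr do rewrite -[letter_weight _ _]mulr1.
by rewrite (sum_letter_weight (fun=> 1))// sumr_const mulrC [h * _]mulrC mulrC.
Qed.

Variable tau : nat -> R.
Hypothesis tauS : forall l, tau l < tau l.+1.

Lemma word_weight_rcons w o : @word_weight R d n tau (rcons w o) =
  word_weight tau w * letter_weight (tau (size w).+1 - tau (size w)) o.
Proof.
rewrite /word_weight size_rcons big_ord_recr /= nth_rcons ltnn eqxx.
by congr (_ * _); apply: eq_bigr => l _; rewrite nth_rcons ltn_ord.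
Qed.

(** An interval of length [h] carries at most one ring with probability
    [expR (- x) * (1 + x)], where [x] is [h] times the number of sites, and
    [1 - x <= expR (- x)] bounds this below by [1 - x ^+ 2]. *)
Lemma sum_word_weight_ge m :
  1 - \sum_(w <- words m) word_weight tau w
    <= \sum_(l < m) (M%:R * (tau l.+1 - tau l)) ^+ 2.
Proof.
suff : 0 <= 1 - \sum_(w <- words m) word_weight tau w
    <= \sum_(l < m) (M%:R * (tau l.+1 - tau l)) ^+ 2 by case/andP.
elim: m => [|m IH].
  by rewrite !big_ord0 /= big_seq1 /word_weight big_ord0 subrr lexx.
rewrite big_words_rcons big_ord_recr /=.
set h := tau m.+1 - tau m; set x := M%:R * h.
have h0 : 0 < h by rewrite subr_gt0.
have x0 : 0 <= x by rewrite mulr_ge0// ltW.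
rewrite [X in 1 - X](_ : _ =
    (\sum_(w <- words m) word_weight tau w) * (expR (- x) * (1 + x))); last first.
  rewrite -sum_letter_weight1// mulr_suml; apply: eq_big_seq => w wm.
  rewrite mulr_sumr; apply: eq_bigr => o _.
  by rewrite word_weight_rcons (size_words wm).
move: IH; set s := \sum_(w <- _) _; set e := \sum_(l < m) _ => /andP[s1 se].
have s0 : 0 <= s.
  by apply: sumr_ge0 => w _; apply: prodr_ge0 => l _; exact: letter_weight_ge0.
set b := expR (- x) * (1 + x).
have b1 : b <= 1.
  by rewrite /b expRN mulrC ler_pdivrMr ?expR_gt0// mul1r expR_ge1Dx.
have b2 : 1 - x ^+ 2 <= b.
  have -> : 1 - x ^+ 2 = (1 - x) * (1 + x) by ring.
  by rewrite ler_wpM2r ?addr_ge0// expR_ge1Dx.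
have b0 : 0 <= b by rewrite mulr_ge0 ?expR_ge0// addr_ge0.
apply/andP; split; nra.
Qed.

End Words.

(** * Almost surely bounded random variables *)

Section BoundedRandomVariables.
Variables (R : realType) (disp : measure_display) (T : measurableType disp).
Variable P : probability T R.
Implicit Types X Z : T -> R.

(** A class of integrable variables that is stable under products, so that the
    polynomials in the configuration are integrable by construction. *)
Definition as_bounded X :=
  measurable_fun setT X /\ exists K : R, {ae P, forall x, `|X x| <= K}.

Lemma as_bounded_cst (c : R) : as_bounded (fun=> c).
Proof. by split; [exact: measurable_cst|exists `|c|; exact: aeW]. Qed.

Lemma as_bounded_indic (A : set T) : measurable A -> as_bounded (\1_A : T -> R).
Proof.
move=> mA; split; first exact/measurable_indicP.
by exists 1; apply: aeW => x; rewrite indicE ger0_norm ?ler0n// lern1 leq_b1.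
Qed.

Lemma as_boundedD X Z : as_bounded X -> as_bounded Z -> as_bounded (fun x => X x + Z x).
Proof.
move=> [mX [K XK]] [mZ [L ZL]]; split; first exact: measurable_funD.
exists (K + L); apply: filterS2 XK ZL => x XK ZL.
by rewrite (le_trans (ler_normD _ _))// lerD.
Qed.

Lemma as_boundedM X Z : as_bounded X -> as_bounded Z -> as_bounded (fun x => X x * Z x).
Proof.
move=> [mX [K XK]] [mZ [L ZL]]; split; first exact: measurable_funM.
exists (K * L); apply: filterS2 XK ZL => x XK ZL.
by rewrite normrM ler_pM.
Qed.

Lemma as_boundedZ c X : as_bounded X -> as_bounded (fun x => c * X x).
Proof. by move=> bX; apply: as_boundedM => //; exact: as_bounded_cst. Qed.

Lemma as_boundedB X Z : as_bounded X -> as_bounded Z -> as_bounded (fun x => X x - Z x).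
Proof.
move=> bX bZ; apply: as_boundedD => //.
by under eq_fun do rewrite -mulN1r; exact: as_boundedZ.
Qed.

Lemma as_bounded_norm X : as_bounded X -> as_bounded (fun x => `|X x|).
Proof.
move=> [mX [K XK]]; split; first exact: measurableT_comp.
by exists K; apply: filterS XK => x; rewrite normr_id.
Qed.

Lemma as_bounded_sum (I : Type) (s : seq I) (Q : pred I) (X : I -> T -> R) :
  (forall i, as_bounded (X i)) -> as_bounded (fun x => \sum_(i <- s | Q i) X i x).
Proof.
move=> bX; elim: s => [|i s IH].
  by under eq_fun do rewrite big_nil; exact: as_bounded_cst.
under eq_fun do rewrite big_cons.
by case: (Q i) => //; exact: as_boundedD.
Qed.

Lemma as_bounded_integrable X : as_bounded X -> P.-integrable setT (EFin \o X).
Proof.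
move=> [mX [K XK]]; apply/integrableP; split; first exact/measurable_EFinP.
apply: (@le_lt_trans _ _ (\int[P]_x `|K|%:E)%E).
  apply: ae_ge0_le_integral => //.
  - by apply/measurable_EFinP; exact: measurableT_comp.
  - by apply: filterS XK => x XK _; rewrite lee_fin (le_trans XK)// ler_norm.
rewrite integral_cst//; apply: lte_mul_pinfty => //.
by apply: (@le_lt_trans _ _ 1%E); [exact: probability_le1|exact: ltry].
Qed.

Lemma meanD X Z : as_bounded X -> as_bounded Z ->
  \int[P]_x (X x + Z x) = \int[P]_x X x + \int[P]_x Z x.
Proof. by move=> bX bZ; rewrite RintegralD//; exact: as_bounded_integrable. Qed.

Lemma meanB X Z : as_bounded X -> as_bounded Z ->
  \int[P]_x (X x - Z x) = \int[P]_x X x - \int[P]_x Z x.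
Proof. by move=> bX bZ; rewrite RintegralB//; exact: as_bounded_integrable. Qed.

Lemma meanZ c X : as_bounded X -> \int[P]_x (c * X x) = c * \int[P]_x X x.
Proof. by move=> bX; rewrite RintegralZl//; exact: as_bounded_integrable. Qed.

Lemma mean_cst (c : R) : \int[P]_x c = c.
Proof.
rewrite Rintegral_cst//; transitivity (c * fine (1%E : \bar R)); last by rewrite mulr1.
by congr (_ * fine _); exact: probability_setT.
Qed.

Lemma mean_sum (I : Type) (s : seq I) (Q : pred I) (X : I -> T -> R) :
  (forall i, as_bounded (X i)) ->
  \int[P]_x (\sum_(i <- s | Q i) X i x) = \sum_(i <- s | Q i) \int[P]_x X i x.
Proof.
move=> bX; elim: s => [|i s IH].
  by rewrite big_nil -[RHS]mean_cst; apply: eq_Rintegral => x _; rewrite big_nil.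
rewrite big_cons; under eq_Rintegral do rewrite big_cons.
case: (Q i) => //; rewrite meanD ?IH//.
exact: as_bounded_sum.
Qed.

Lemma mean_indic (A : set T) : measurable A -> \int[P]_x \1_A x = fine (P A).
Proof. by move=> mA; rewrite /Rintegral integral_indic// setIT. Qed.

Lemma ae_eq_mean X Z : as_bounded X -> as_bounded Z ->
  {ae P, forall x, X x = Z x} -> \int[P]_x X x = \int[P]_x Z x.
Proof.
move=> [mX _] [mZ _] XZ; congr fine; apply: ae_eq_integral => //.
- exact/measurable_EFinP.
- exact/measurable_EFinP.
- by apply: filterS XZ => x -> _.
Qed.

Lemma ae_le_mean X Z : as_bounded X -> as_bounded Z ->
  {ae P, forall x, X x <= Z x} -> \int[P]_x X x <= \int[P]_x Z x.
Proof.
move=> bX bZ XZ; rewrite -subr_ge0 -meanB//.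
have bZX := as_boundedB bZ bX.
rewrite (ae_eq_mean bZX (as_bounded_norm bZX)); first exact: Rintegral_ge0.
by apply: filterS XZ => x XZ; rewrite ger0_norm// subr_ge0.
Qed.

Lemma ae_normr_mean_le X Z : as_bounded X -> as_bounded Z ->
  {ae P, forall x, `|X x| <= Z x} -> `|\int[P]_x X x| <= \int[P]_x Z x.
Proof.
move=> bX bZ XZ; apply: (@le_trans _ _ (\int[P]_x `|X x|)).
  by apply: le_normr_Rintegral => //; exact: as_bounded_integrable.
by apply: ae_le_mean => //; exact: as_bounded_norm.
Qed.

Lemma as_bounded_expectation X : as_bounded X ->
  ('E_P[X] = (\int[P]_x X x)%:E)%E.
Proof.
move=> bX; rewrite unlock /Rintegral fineK//.
by apply: integrable_fin_num => //; exact: as_bounded_integrable.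
Qed.

End BoundedRandomVariables.

(** * Expectation over one small step of time *)

Section FineGrid.
Variables (R : realType) (M : nat).

(** For [0 < s] the grid cuts the time before [s] into [m] equal intervals; for
    [s = 0] this has to be the empty subdivision, [m = 0]. *)
Lemma fine_grid (s h e : R) : 0 <= s -> 0 < h -> 0 < e ->
  exists (tau : nat -> R) (m : nat),
  [/\ tau 0%N = 0, forall l, tau l < tau l.+1, tau m = s, tau m.+1 = s + h &
      \sum_(l < m) (M%:R * (tau l.+1 - tau l)) ^+ 2 <= e].
Proof.
move=> s0 h0 e0.
move: s0; rewrite le_eqVlt => /predU1P[<-|s0].
  exists (fun l => l%:R * h), 0%N; split; rewrite ?mul0r// ?mul1r ?add0r//.
    by move=> l; rewrite ltr_pM2r// ltr_nat.
  by rewrite big_ord0 ltW.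
pose m := (Num.truncn ((M%:R * s) ^+ 2 / e)).+1.
have mE : (M%:R * s) ^+ 2 / e <= m%:R by rewrite ltW// truncnS_gt.
have m0 : 0 < m%:R :> R by rewrite ltr0n.
exists (fun l => if (l <= m)%N then l%:R * (s / m%:R) else s + (l - m)%:R * h), m.
split => [|l|||].
- by rewrite mul0r.
- case: ltnP => lm; first by rewrite ltnW// ltr_pM2r ?divr_gt0// ltr_nat.
  case: ifPn => lm'.
    have -> : l = m by apply/eqP; rewrite eqn_leq lm' -ltnS.
    by rewrite mulrCA divff ?gt_eqF// mulr1 subSnn mul1r ltrDl.
  by rewrite ltrD2l ltr_pM2r// ltr_nat subSn// ltnW// ltnNge.
- by rewrite leqnn mulrCA divff ?gt_eqF// mulr1.
- by rewrite ltnn subSnn mul1r.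
- under eq_bigr => l _.
    rewrite ltn_ord (ltnW (ltn_ord l)) -mulrBl -natrB// subSnn mul1r.
    over.
  rewrite sumr_const card_ord -(mulr_natr (_ ^+ 2)).
  have -> : (M%:R * (s / m%:R)) ^+ 2 * m%:R = (M%:R * s) ^+ 2 / m%:R.
    by field; rewrite gt_eqF.
  rewrite ler_pdivrMr// [e * _]mulrC -ler_pdivrMr//.
Qed.

End FineGrid.

Section StepMoments.
Variables (R : realType) (disp : measure_display) (T : measurableType disp).
Variables (P : probability T R) (d n : nat).
Variables (N : torus d n -> R -> {RV P >-> nat}) (Y : R -> torus d n -> {RV P >-> R}).
Hypothesis hY : smoothing_process N Y.
Hypothesis hY0 : {ae P, forall w, forall i, Y 0 i w = (i == 0)%:R}.
Implicit Types (w v : seq (option (torus d n))).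

Notation M := #|{: torus d n}|.

Definition unit_mass (i : torus d n) : R := (i == 0)%:R.

Definition run w := foldl (@step R d n) unit_mass w.

Lemma run01 w i : 0 <= run w i <= 1.
Proof.
elim/last_ind: w i => [|w o IH] i.
  by rewrite /run /= /unit_mass; case: (_ == _); rewrite ?lexx ler01.
by rewrite /run foldl_rcons; exact: step01.
Qed.

Lemma measurable_cube t : measurable [set x | forall i, 0 <= Y t i x <= 1].
Proof.
rewrite [X in measurable X](_ : _ = \bigcap_(i in [set: torus d n]) (Y t i @^-1` `[0, 1])).
  apply: fin_bigcap_measurable => [|i _]; first exact: finite_finset.
  by rewrite -[X in measurable X]setTI; exact: (measurable_funP (Y t i)).
by apply/seteqP; split=> x /= h i; [move=> _ /=|]; rewrite ?in_itv /=; have := h i;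
  rewrite /= ?in_itv //=; apply.
Qed.

Section Grid.
Variable tau : nat -> R.
Hypotheses (tau0 : tau 0%N = 0) (tauS : forall l, tau l < tau l.+1).

Lemma word_event_inj w v x : size w = size v ->
  word_event N tau w x -> word_event N tau v x -> w = v.
Proof.
move=> wv hw hv; apply: (@eq_from_nth _ None) => // l lw.
have wvk k : (nth None w l == Some k) = (nth None v l == Some k).
  have /= := hw k I l; rewrite mem_iota => /(_ lw) wE.
  have /= := hv k I l; rewrite mem_iota -wv => /(_ lw); rewrite wE.
  by do 2 case: (_ == Some k).
case wl : (nth None w l) => [k|]; first by apply/esym/eqP; rewrite -wvk wl.
case vl : (nth None v l) => [k|]//.
by have := wvk k; rewrite wl vl eqxx.
Qed.

(** The events of the words of a given length are disjoint: at most one term of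
    such a sum survives. *)
Lemma sum_word_indic m x :
  (exists w, [/\ w \in words d n m, word_event N tau w x &
    forall F : _ -> R, \sum_(v <- words d n m) F v * \1_(word_event N tau v) x = F w]) \/
  (forall F : _ -> R, \sum_(v <- words d n m) F v * \1_(word_event N tau v) x = 0).
Proof.
have [[w [wm wx]]|nw] := pselect (exists w, w \in words d n m /\ word_event N tau w x).
  left; exists w; split => // F.
  rewrite (bigD1_seq w)//= ?uniq_words// indicE mem_set// mulr1 big_seq_cond big1 ?addr0//.
  move=> v /andP[vm vw]; rewrite indicE memNset ?mulr0// => vx.
  move: vw; rewrite (word_event_inj _ wx vx) ?eqxx//.
  by rewrite (size_words wm) (size_words vm).
right=> F; rewrite big_seq big1// => v vm; rewrite indicE memNset ?mulr0// => vx.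
by apply: nw; exists v.
Qed.

Let S m x : R := \sum_(w <- words d n m) \1_(word_event N tau w) x.

Let SE m x : S m x = \sum_(w <- words d n m) 1 * \1_(word_event N tau w) x.
Proof. by apply: eq_bigr => w _; rewrite mul1r. Qed.

Let bounded_wi w : as_bounded P (\1_(word_event N tau w) : T -> R).
Proof. by apply: as_bounded_indic; exact: measurable_word_event. Qed.

Let bounded_S m : as_bounded P (S m).
Proof. exact: as_bounded_sum. Qed.

Let mean_S m : \int[P]_x S m x = \sum_(w <- words d n m) word_weight tau w.
Proof.
rewrite /S mean_sum//; apply: eq_bigr => w _.
by rewrite mean_indic ?(probability_word_event hY)//; exact: measurable_word_event.
Qed.

Lemma word_dynamics m : {ae P, forall x, forall w, w \in words d n m ->
  word_event N tau w x -> Y (tau m) ^~ x = run w}.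
Proof.
apply: filterS2 (word_event_dynamics hY tau0 tauS) hY0 => x dyn Y0 w wm wx.
apply/funext => i; rewrite -(size_words wm) dyn// /run.
by congr (foldl _ _ w i); apply/funext => j; rewrite Y0.
Qed.

(** On a word event the configuration is obtained from the unit mass by
    averaging, hence it can leave the cube only where no word describes the
    rings. *)
Lemma prob_outside_cube m :
  \int[P]_x \1_(~` [set x | forall i, 0 <= Y (tau m) i x <= 1]) x <=
    \sum_(l < m) (M%:R * (tau l.+1 - tau l)) ^+ 2.
Proof.
have mC := measurableC (measurable_cube (tau m)).
apply: le_trans (sum_word_weight_ge d n tauS m).
rewrite -mean_S -[X in X - _](mean_cst P) -meanB//; last exact: as_bounded_cst.
apply: ae_le_mean; first exact: as_bounded_indic.
  by apply: as_boundedB => //; exact: as_bounded_cst.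
apply: filterS (word_dynamics m) => x dyn.
have [[w [wm wx S1]]|S0] := sum_word_indic m x; last first.
  by rewrite SE S0 subr0 indicE lern1 leq_b1.
rewrite SE S1 subrr indicE memNset// => -[] i.
by have := dyn _ wm wx => /(congr1 (@^~ i)) ->; exact: run01.
Qed.

End Grid.

(** The bound of [prob_outside_cube] tends to [0] with the mesh of the grid. *)
Lemma ae_cube t : 0 <= t -> {ae P, forall x, forall i, 0 <= Y t i x <= 1}.
Proof.
move=> t0; have mC := measurableC (measurable_cube t).
exists (~` [set x | forall i, 0 <= Y t i x <= 1]); split => //.
have : fine (P (~` [set x | forall i, 0 <= Y t i x <= 1])) <= 0.
  apply/ler_addgt0Pr => e e0; rewrite add0r -mean_indic//.
  have [tau [m [tau0 tauS taum _ le_e]]] := fine_grid M t0 ltr01 e0.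
  apply: le_trans le_e; rewrite -taum; exact: prob_outside_cube.
move=> C0; apply/eqP; rewrite eq_le measure_ge0 andbT -(fineK (fin_num_measure _ _ mC)).
by rewrite lee_fin.
Qed.

(** Measurability of [f] tested on families of random variables, which spares
    the choice of a sigma-algebra on configurations. *)
Definition borel_statistic (f : (torus d n -> R) -> R) :=
  forall X : torus d n -> T -> R, (forall i, measurable_fun setT (X i)) ->
    measurable_fun setT (fun x => f (X ^~ x)).

Lemma as_bounded_statistic f K t : borel_statistic f -> 0 <= t ->
  (forall y, (forall i, 0 <= y i <= 1) -> `|f y| <= K) ->
  as_bounded P (fun x => f (Y t ^~ x)).
Proof.
move=> mf t0 fK; split; first by apply: mf => i; exact: measurable_funP.
by exists K; apply: filterS (ae_cube t0) => x Yx; exact: fK.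
Qed.

(** On a word event the statistic is its value along the run. Outside the word
    events it is at most [K], and their complement has the probability bounded
    in [sum_word_weight_ge]. *)
Lemma grid_approximation f K (tau : nat -> R) m :
  borel_statistic f -> (forall y, (forall i, 0 <= y i <= 1) -> `|f y| <= K) ->
  tau 0%N = 0 -> (forall l, tau l < tau l.+1) ->
  `|\int[P]_x f (Y (tau m) ^~ x) - \sum_(w <- words d n m) word_weight tau w * f (run w)|
    <= K * \sum_(l < m) (M%:R * (tau l.+1 - tau l)) ^+ 2.
Proof.
move=> mf fK tau0 tauS.
have taum0 : 0 <= tau m by apply: tau_ge0.
have K0 : 0 <= K by rewrite (le_trans _ (fK (run [::]) (run01 _)))//.
have bf := as_bounded_statistic mf taum0 fK.
have bwi w : as_bounded P (\1_(word_event N tau w) : T -> R).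
  by apply: as_bounded_indic; exact: measurable_word_event.
have bg : as_bounded P
    (fun x => \sum_(w <- words d n m) f (run w) * \1_(word_event N tau w) x).
  by apply: as_bounded_sum => w; exact: as_boundedZ.
apply: (@le_trans _ _ (K * (1 - \sum_(w <- words d n m) word_weight tau w))); last first.
  by rewrite ler_wpM2l// sum_word_weight_ge.
have -> : \sum_(w <- words d n m) word_weight tau w =
    \int[P]_x \sum_(w <- words d n m) 1 * \1_(word_event N tau w) x.
  rewrite mean_sum; last by move=> w; exact: as_boundedZ.
  apply: eq_bigr => w _.
  rewrite meanZ// mean_indic ?(probability_word_event hY)// ?mul1r//.
  exact: measurable_word_event.
have -> : \sum_(w <- words d n m) word_weight tau w * f (run w) =
    \int[P]_x \sum_(w <- words d n m) f (run w) * \1_(word_event N tau w) x.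
  rewrite mean_sum; last by move=> w; exact: as_boundedZ.
  apply: eq_bigr => w _.
  rewrite meanZ// mean_indic ?(probability_word_event hY)// 1?mulrC//.
  exact: measurable_word_event.
have bS : as_bounded P
    (fun x => 1 - \sum_(w <- words d n m) 1 * \1_(word_event N tau w) x).
  apply: as_boundedB; first exact: as_bounded_cst.
  by apply: as_bounded_sum => w; exact: as_boundedZ.
rewrite -meanB// -[X in K * (X - _)](mean_cst P) -meanB//; last 2 first.
  exact: as_bounded_cst.
  by apply: as_bounded_sum => w; exact: as_boundedZ.
rewrite -meanZ//; apply: ae_normr_mean_le; [exact: as_boundedB|exact: as_boundedZ|].
apply: filterS2 (ae_cube taum0) (word_dynamics tau0 tauS m) => x Yx dyn.
have [[w [wm wx S1]]|S0] := sum_word_indic tau m x.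
  by rewrite !S1 (dyn _ wm wx) !subrr mulr0 normr0.
by rewrite !S0 !subr0 mulr1 fK.
Qed.

(** The expectation of [f] an interval of length [h] after the configuration
    [y], restricted to the event that at most one clock rings meanwhile. *)
Definition step_mean (h : R) (f : (torus d n -> R) -> R) (y : torus d n -> R) : R :=
  expR (- (M%:R * h)) * (f y + h * \sum_k f (average_at y k)).

Lemma borel_step_mean h f : borel_statistic f -> borel_statistic (step_mean h f).
Proof.
move=> mf X mX; apply: measurable_funM => //; apply: measurable_funD; first exact: mf.
apply: measurable_funM => //; apply: measurable_sum => k.
apply: (mf (fun i x => average_at (X ^~ x) k i)) => i; rewrite /average_at.
case: (i == k) => //; apply: measurable_funM => //.
by under eq_fun do rewrite -big_filter; exact: measurable_sum.
Qed.

Lemma step_mean_le h f K : 0 < h ->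
  (forall y, (forall i, 0 <= y i <= 1) -> `|f y| <= K) ->
  forall y, (forall i, 0 <= y i <= 1) -> `|step_mean h f y| <= K.
Proof.
move=> h0 fK y y01; have K0 : 0 <= K by rewrite (le_trans _ (fK _ y01)).
rewrite /step_mean normrM ger0_norm ?expR_ge0//.
rewrite -ler_pdivlMl ?expR_gt0// -expRN opprK.
apply: (@le_trans _ _ (K + h * (\sum_(k : torus d n) K))).
  rewrite (le_trans (ler_normD _ _))// lerD ?fK// normrM gtr0_norm// ler_pM2l//.
  rewrite (le_trans (ler_norm_sum _ _ _))// ler_sum// => k _; apply: fK => i.
  exact: (step01 (Some k)).
rewrite [X in _ <= X]mulrC.
have -> : \sum_(k : torus d n) K = K * M%:R by rewrite sumr_const mulr_natr.
have -> : K + h * (K * M%:R) = K * (1 + M%:R * h) by ring.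
by rewrite ler_wpM2l// expR_ge1Dx.
Qed.

(** This plays the part of the Markov property at time [s]. The sums over words
    approximating the two expectations, on a fine grid of [0, s] with and without
    a last interval of length [h], are equal: summing over the last letter of the
    longer words produces [step_mean]. The error made before [s] vanishes with
    the mesh, and that of the last interval remains. *)
Lemma one_step_estimate f K s h : borel_statistic f ->
  (forall y, (forall i, 0 <= y i <= 1) -> `|f y| <= K) -> 0 <= s -> 0 < h ->
  `|\int[P]_x f (Y (s + h) ^~ x) - \int[P]_x step_mean h f (Y s ^~ x)|
    <= K * (M%:R * h) ^+ 2.
Proof.
move=> mf fK s0 h0.
have K0 : 0 <= K by rewrite (le_trans _ (fK (run [::]) (run01 _)))//.
apply/ler_addgt0Pr => e e0.
(* the errors made before [s], at most [K] times the sum of squares each, will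
   share [e] *)
have e'0 : 0 < e / (2 * (K + 1)) by rewrite divr_gt0// mulr_gt0// ltr_wpDl.
have [tau [m [tau0 tauS taum taumS le_e]]] := fine_grid M s0 h0 e'0.
have := grid_approximation m.+1 mf fK tau0 tauS.
have := grid_approximation m (borel_step_mean h mf) (step_mean_le h0 fK) tau0 tauS.
rewrite big_words_rcons big_ord_recr /= taumS taum addrAC subrr add0r.
have -> : \sum_(w <- words d n m) word_weight tau w * step_mean h f (run w) =
  \sum_(w <- words d n m) \sum_o word_weight tau (rcons w o) * f (run (rcons w o)).
  apply: eq_big_seq => w wm.
  rewrite /step_mean -(sum_letter_weight (fun o => f (step (run w) o)))//.
  rewrite mulr_sumr; apply: eq_bigr => o _.
  rewrite word_weight_rcons (size_words wm) taumS taum addrAC subrr add0r mulrA.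
  by rewrite /run foldl_rcons.
move: le_e; set a := \sum_(w <- _) _; set q := \sum_(l < m) _.
set A := \int[P]_x _; set B := \int[P]_x _; set c := (_ * h) ^+ 2 => qe Ba Aa.
have qK : K * q <= e / 2.
  apply: (@le_trans _ _ (K * (e / (2 * (K + 1))))); first by rewrite ler_wpM2l.
  have -> : e / 2 = (K + 1) * (e / (2 * (K + 1))) by field; rewrite gt_eqF// ltr_wpDl.
  by rewrite ler_wpM2r ?ltW// ltrDl.
move: Ba Aa; rewrite !ler_norml => /andP[B1 B2] /andP[A1 A2].
apply/andP; split; lra.
Qed.

End StepMoments.

(** * Evolution of the second moments *)

Section LaplacianAlgebra.
Variables (R : realType) (d n : nat).
Implicit Types (i j k : torus d n) (y f g : torus d n -> R).

Lemma laplacianZr f c i : laplacian f i * c = laplacian (fun a => f a * c) i.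
Proof. by rewrite /laplacian /neighbor_mean mulrBl -mulrA mulr_suml. Qed.

Lemma laplacianZl f c i : c * laplacian f i = laplacian (fun a => c * f a) i.
Proof. by rewrite /laplacian /neighbor_mean mulrBr mulrCA mulr_sumr. Qed.

Lemma eq_laplacian f g i : f =1 g -> laplacian f i = laplacian g i.
Proof. by move=> fg; rewrite /laplacian (eq_neighbor_mean _ fg) fg. Qed.

Lemma average_atE y k i : average_at y k i = y i + (i == k)%:R * laplacian y k.
Proof.
rewrite /average_at /laplacian; case: eqP => [->|_]; last by rewrite mul0r addr0.
by rewrite mul1r addrC subrK.
Qed.

Lemma laplacian_cube_le y i : (forall j, 0 <= y j <= 1) -> `|laplacian y i| <= 1.
Proof.
move=> y01; have /andP[m0 m1] := neighbor_mean01 i y01; have /andP[y0 y1] := y01 i.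
by rewrite /laplacian ler_norml; apply/andP; split; lra.
Qed.

(** The jump generator of the process on the monomial [y i * y j]: a ring at [k]
    adds [laplacian y k] to the coordinate [k], which matters for [k = i] and
    for [k = j], with a cross term when both hold. *)
Definition pair_generator i j y : R :=
  laplacian y i * y j + y i * laplacian y j + (i == j)%:R * laplacian y i ^+ 2.

Lemma sum_average_at_pair y i j :
  \sum_k average_at y k i * average_at y k j =
  #|{: torus d n}|%:R * (y i * y j) + pair_generator i j y.
Proof.
under eq_bigr => k _.
  rewrite !average_atE.
  rewrite (_ : _ * _ = y i * y j + (k == i)%:R * (laplacian y k * y j)
     + (k == j)%:R * (y i * laplacian y k) +
       (k == i)%:R * ((k == j)%:R * laplacian y k ^+ 2)); last first.
    by rewrite !(eq_sym k); ring.
  over.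
rewrite !big_split /= sumr_const -[X in X + _ + _ + _]mulr_natl.
have pick (F : torus d n -> R) a : \sum_k (k == a)%:R * F k = F a.
  rewrite (bigD1 a)//= eqxx mul1r big1 ?addr0// => k /negPf ->.
  by rewrite mul0r.
rewrite (pick (fun k => laplacian y k * y j)) (pick (fun k => y i * laplacian y k)).
rewrite (pick (fun k => (k == j)%:R * laplacian y k ^+ 2)) -!addrA.
by rewrite /pair_generator !addrA.
Qed.

End LaplacianAlgebra.

Section SecondMoments.
Variables (R : realType) (disp : measure_display) (T : measurableType disp).
Variables (P : probability T R) (d n : nat).
Variables (N : torus d n -> R -> {RV P >-> nat}) (Y : R -> torus d n -> {RV P >-> R}).
Hypothesis hY : smoothing_process N Y.
Hypothesis hY0 : {ae P, forall w, forall i, Y 0 i w = (i == 0)%:R}.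

Notation M := #|{: torus d n}|.

Definition pair_moment t i j : R := \int[P]_x (Y t i x * Y t j x).

Definition moment_rate t i j : R := \int[P]_x pair_generator i j (Y t ^~ x).

Lemma borel_coord i : borel_statistic T (fun y : torus d n -> R => y i).
Proof. by move=> X; exact. Qed.

Lemma borel_laplacian i : borel_statistic T (fun y : torus d n -> R => laplacian y i).
Proof.
move=> X mX; apply: measurable_funB => //; apply: measurable_funM => //.
by under eq_fun do rewrite -big_filter; exact: measurable_sum.
Qed.

Lemma borel_pair i j : borel_statistic T (fun y : torus d n -> R => y i * y j).
Proof. by move=> X mX; exact: measurable_funM. Qed.

Lemma borel_pair_generator i j : borel_statistic T (@pair_generator R d n i j).
Proof.
move=> X mX; have mL a := borel_laplacian a mX.
apply: measurable_funD; first by apply: measurable_funD; apply: measurable_funM.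
by apply: measurable_funM => //; under eq_fun do rewrite expr2; exact: measurable_funM.
Qed.

Lemma pair_le1 i j (y : torus d n -> R) : (forall a, 0 <= y a <= 1) -> `|y i * y j| <= 1.
Proof.
move=> y01; have /andP[i0 i1] := y01 i; have /andP[j0 j1] := y01 j.
by rewrite ger0_norm ?mulr_ge0// mulr_ile1.
Qed.

Lemma pair_generator_le i j (y : torus d n -> R) :
  (forall a, 0 <= y a <= 1) -> `|pair_generator i j y| <= 3.
Proof.
move=> y01; have Li := laplacian_cube_le i y01; have Lj := laplacian_cube_le j y01.
have le1 a : `|y a| <= 1 by have /andP[a0 a1] := y01 a; rewrite ger0_norm.
rewrite /pair_generator (le_trans (ler_normD _ _))//.
have -> : 3 = 1 + 1 + 1 :> R by ring.
apply: lerD; first rewrite (le_trans (ler_normD _ _))// lerD//.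
- by rewrite normrM mulr_ile1.
- by rewrite normrM mulr_ile1.
- rewrite normrM mulr_ile1//; first by case: (_ == _); rewrite ?normr0 ?normr1.
  by rewrite normrX exprn_ile1.
Qed.

Lemma as_bounded_coord t i : 0 <= t -> as_bounded P (Y t i).
Proof.
move=> t0; apply: (as_bounded_statistic hY hY0 (borel_coord i) t0 (K := 1)) => y y01.
by have /andP[a0 a1] := y01 i; rewrite ger0_norm.
Qed.

Lemma as_bounded_pair t i j : 0 <= t -> as_bounded P (fun x => Y t i x * Y t j x).
Proof. by move=> t0; apply: as_boundedM; exact: as_bounded_coord. Qed.

Lemma as_bounded_generator t i j : 0 <= t ->
  as_bounded P (fun x => pair_generator i j (Y t ^~ x)).
Proof.
move=> t0; have b := borel_pair_generator i j.
by apply: (as_bounded_statistic hY hY0 b t0 (K := 3)) => y /pair_generator_le.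
Qed.

Lemma mean_cube_le (f : (torus d n -> R) -> R) K t : borel_statistic T f ->
  (forall y, (forall i, 0 <= y i <= 1) -> `|f y| <= K) -> 0 <= t ->
  `|\int[P]_x f (Y t ^~ x)| <= K.
Proof.
move=> mf fK t0; rewrite -[leRHS](mean_cst P); apply: ae_normr_mean_le.
- exact: (as_bounded_statistic hY hY0 mf t0 fK).
- exact: as_bounded_cst.
- by apply: filterS (ae_cube hY hY0 t0) => x; exact: fK.
Qed.

(** The error is uniform in [s], so the expansion can also be used around an
    earlier time [s] to reach left derivatives. *)
Lemma pair_moment_expansion s h i j : 0 <= s -> 0 < h ->
  `|pair_moment (s + h) i j - pair_moment s i j - h * moment_rate s i j|
     <= (2 * M%:R ^+ 2 + 3 * M%:R) * h ^+ 2.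
Proof.
move=> s0 h0.
have := one_step_estimate hY hY0 (@borel_pair i j) (fun y => @pair_le1 i j y) s0 h0.
rewrite mul1r.
have -> : \int[P]_x step_mean h (fun y => y i * y j) (Y s ^~ x) =
    expR (- (M%:R * h)) * ((1 + M%:R * h) * pair_moment s i j + h * moment_rate s i j).
  rewrite /step_mean.
  under eq_Rintegral => x _.
    rewrite sum_average_at_pair (_ : _ * _ =
      expR (- (M%:R * h)) * (1 + M%:R * h) * (Y s i x * Y s j x) +
      expR (- (M%:R * h)) * h * pair_generator i j (Y s ^~ x)); last by ring.
    over.
  have bp := as_bounded_pair i j s0; have bg := as_bounded_generator i j s0.
  rewrite meanD; [|exact: as_boundedZ|exact: as_boundedZ].
  by rewrite !meanZ//; rewrite /pair_moment /moment_rate; ring.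
have := mean_cube_le (@borel_pair i j) (fun y => @pair_le1 i j y) s0.
have := mean_cube_le (@borel_pair_generator i j) (fun y => @pair_generator_le i j y) s0.
rewrite -/(pair_moment s i j) -/(moment_rate s i j) -/(pair_moment (s + h) i j).
set C := pair_moment s i j; set D := moment_rate s i j; set C' := pair_moment _ i j.
move=> D3 C1.
have M0 : 0 <= M%:R :> R by [].
set x := M%:R * h; have x0 : 0 <= x by rewrite mulr_ge0// ltW.
set e := expR (- x).
have e1 : e <= 1 by rewrite -expR0 ler_expR oppr_le0.
have e2 : 1 - x <= e by exact: expR_ge1Dx.
have b1 : e * (1 + x) <= 1.
  by rewrite /e expRN mulrC ler_pdivrMr ?expR_gt0// mul1r expR_ge1Dx.
have b2 : 1 - x ^+ 2 <= e * (1 + x).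
  have -> : 1 - x ^+ 2 = (1 - x) * (1 + x) by ring.
  by rewrite ler_wpM2r// addr_ge0.
move=> est.
(* the one-step error, then the defects of the coefficients of [C] and [h * D] *)
have -> : C' - C - h * D = (C' - e * ((1 + x) * C + h * D)) +
    ((e * (1 + x) - 1) * C + (e - 1) * (h * D)) by ring.
have -> : (2 * M%:R ^+ 2 + 3 * M%:R) * h ^+ 2 =
  x ^+ 2 + (x ^+ 2 * 1 + x * (h * 3)) by rewrite /x; ring.
rewrite (le_trans (ler_normD _ _))// lerD// (le_trans (ler_normD _ _))// lerD//.
  by rewrite normrM ler_pM// ler_norml; apply/andP; split; lra.
rewrite normrM ler_pM//; first by rewrite ler_norml; apply/andP; split; lra.
by rewrite normrM gtr0_norm// ler_pM2l.
Qed.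

Lemma mean_laplacian (X : torus d n -> T -> R) i : (forall j, as_bounded P (X j)) ->
  as_bounded P (fun x => laplacian (X ^~ x) i) /\
  \int[P]_x laplacian (X ^~ x) i = laplacian (fun j => \int[P]_x X j x) i.
Proof.
move=> bX.
have b1 : as_bounded P (fun x => neighbor_mean (X ^~ x) i).
  by apply: as_boundedZ; exact: as_bounded_sum.
split; first exact: as_boundedB.
rewrite meanB//; congr (_ - _).
by rewrite meanZ ?mean_sum//; exact: as_bounded_sum.
Qed.

Definition laplacian_sq_moment t i : R := \int[P]_x laplacian (Y t ^~ x) i ^+ 2.

Lemma laplacian_sq_momentE t i : 0 <= t ->
  laplacian_sq_moment t i = laplacian (fun a => laplacian (fun b => pair_moment t a b) i) i.
Proof.
move=> t0; have bYY a b := as_bounded_pair a b t0.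
have H a := mean_laplacian i (bYY a).
rewrite -(eq_laplacian i (fun a => (H a).2)).
rewrite -(mean_laplacian i (fun a => (H a).1)).2.
apply: eq_Rintegral => x _.
rewrite expr2 laplacianZr; apply: eq_laplacian => a.
by rewrite laplacianZl.
Qed.

Lemma moment_rateE t i j : 0 <= t -> moment_rate t i j =
  laplacian (fun a => pair_moment t a j) i + laplacian (fun b => pair_moment t i b) j
  + (i == j)%:R * laplacian_sq_moment t i.
Proof.
move=> t0; have bYY a b := as_bounded_pair a b t0.
have [b1 e1] := mean_laplacian i (fun a => bYY a j).
have [b2 e2] := mean_laplacian j (fun b => bYY i b).
rewrite -e1 -e2 /laplacian_sq_moment.
have bL : as_bounded P (fun x => laplacian (Y t ^~ x) i).
  by have [] := mean_laplacian i (fun a => as_bounded_coord a t0).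
have b3 : as_bounded P (fun x => laplacian (Y t ^~ x) i ^+ 2).
  by under eq_fun do rewrite expr2; exact: as_boundedM.
rewrite -meanZ// -meanD// -meanD//; [|exact: as_boundedD|exact: as_boundedZ].
apply: eq_Rintegral => x _; rewrite /pair_generator; congr (_ + _ + _).
- exact: laplacianZr.
- exact: laplacianZl.
Qed.

End SecondMoments.

(** * Calculus on the half-line *)

Section HalfLine.
Variable R : realType.
Implicit Types (F G f g : R -> R).

(** Freezing a function at its initial value before time [0] turns one-sided
    continuity at [0] into continuity on the line. *)
Definition ext F : R -> R := fun t => F (Num.max 0 t).

Lemma extE F t : 0 <= t -> ext F t = F t.
Proof. by move=> t0; rewrite /ext max_r. Qed.

Let near_dist (t e : R) : 0 < e -> \forall s \near t, `|t - s| <= e.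
Proof.
move=> e0; have : (fun s : R => s) s @[s --> t] --> t by exact: cvg_id.
by move/cvgrPdist_le/(_ e e0).
Qed.

Let near_ge0 (t : R) : 0 < t -> \forall s \near t, 0 <= s.
Proof.
move=> t0; have : (fun s : R => s) s @[s --> t] --> t by exact: cvg_id.
by move/cvgr_ge/(_ 0 t0).
Qed.

Lemma ext_is_derive F (t D : R) : 0 < t -> is_derive t 1 F D -> is_derive t 1 (ext F) D.
Proof.
move=> t0; apply: near_eq_is_derive.
by near=> s; rewrite extE//; near: s; exact: near_ge0.
Unshelve. all: by end_near. Qed.

Lemma ext_continuous F : F s @[s --> 0^'+] --> F 0 ->
  (forall t : R, 0 < t -> {for t, continuous F}) -> continuous (ext F).
Proof.
move=> F0 cF t; have [t0|t0|<-] := ltgtP 0 t.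
- rewrite /continuous_at extE ?(ltW t0)//; apply: cvg_trans (cF t t0).
  apply: near_eq_cvg; near=> s; rewrite extE//; near: s; exact: near_ge0.
- apply: (@near_cst_continuous _ _ (F 0)); near=> s; rewrite /ext max_l//.
  by near: s; exact: lt_le_nbhsl.
- apply/left_right_continuousP; rewrite extE//; split.
    by apply: cvg_near_cst; apply: filterS (nbhs_left_le 0) => s s0; rewrite /ext max_l.
  apply: cvg_trans F0; apply: near_eq_cvg.
  by apply: filterS (nbhs_right_ge 0) => s s0; rewrite extE.
Unshelve. all: by end_near. Qed.

(** A linear class of functions of positive times that serves three purposes:
    continuity, passing from right to two-sided derivatives, and continuity of
    convolutions. *)
Definition loc_lip F := forall U : R, 0 <= U -> exists L : R, forall a b : R,
  0 <= a -> a <= b -> b <= U -> `|F b - F a| <= L * (b - a).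

Lemma loc_lip_continuous F : loc_lip F -> continuous (ext F).
Proof.
move=> lF t; have t1 : 0 <= Num.max 0 t + 1 by rewrite addr_ge0 ?le_max ?lexx.
have [L hL] := lF _ t1.
have lip a b : 0 <= a -> 0 <= b -> a <= Num.max 0 t + 1 -> b <= Num.max 0 t + 1 ->
    `|F b - F a| <= `|L| * `|b - a|.
  wlog ab : a b / a <= b => [H a0 b0 aU bU|a0 b0 aU bU].
    by have [/H|/ltW/H] := leP a b; last rewrite distrC [ `|b - a| ]distrC; exact.
  rewrite (le_trans (hL a b _ _ _))// [ `|b - a| ]ger0_norm ?subr_ge0//.
  by rewrite ler_wpM2r ?subr_ge0// ler_norm.
apply/cvgrPdist_le => e e0; near=> s.
have st : `|t - s| <= 1 by near: s; exact: near_dist.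
have ste : `|t - s| <= e / (`|L| + 1).
  by near: s; apply: near_dist; rewrite divr_gt0// ltr_wpDl.
have maxd : `|Num.max 0 t - Num.max 0 s| <= `|t - s|.
  rewrite ler_norml; apply/andP; case: (leP 0 t) => ?; case: (leP 0 s) => ?;
  have := ler_norm (t - s); have := ler_norm (- (t - s)); rewrite normrN; split; lra.
rewrite /ext (le_trans (lip _ _ _ _ _ _)) ?le_max ?lexx//.
- by rewrite -lerBlDl (le_trans _ st)// (le_trans _ maxd)// distrC ler_norm.
- by rewrite lerDl.
- rewrite (le_trans (ler_wpM2l _ (le_trans maxd ste)))// mulrCA ger_pMr//.
  by rewrite ler_pdivrMr ?ltr_wpDl// mul1r lerDl.
Unshelve. all: by end_near. Qed.

Lemma loc_lipD F G : loc_lip F -> loc_lip G -> loc_lip (fun t => F t + G t).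
Proof.
move=> lF lG U U0; have [L hL] := lF U U0; have [K hK] := lG U U0.
exists (L + K) => a b a0 ab bU.
have -> : F b + G b - (F a + G a) = (F b - F a) + (G b - G a) by ring.
by rewrite (le_trans (ler_normD _ _))// mulrDl lerD ?hL ?hK.
Qed.

Lemma loc_lipZ c F : loc_lip F -> loc_lip (fun t => c * F t).
Proof.
move=> lF U U0; have [L hL] := lF U U0.
exists (`|c| * L) => a b a0 ab bU.
by rewrite -mulrBr normrM -mulrA ler_wpM2l// hL.
Qed.

Lemma loc_lip0 : loc_lip (fun=> 0).
Proof. by move=> U U0; exists 0 => a b _ _ _; rewrite subrr normr0 mul0r. Qed.

Lemma loc_lip_sum (I : Type) (s : seq I) (Q : pred I) (F : I -> R -> R) :
  (forall i, loc_lip (F i)) -> loc_lip (fun t => \sum_(i <- s | Q i) F i t).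
Proof.
move=> lF; elim: s => [|i s IH].
  by under eq_fun do rewrite big_nil; exact: loc_lip0.
under eq_fun do rewrite big_cons.
by case: (Q i) => //; exact: loc_lipD.
Qed.

(** On the right of [t] the expansion is the derivative. On the left it is used
    around [t + h], and the Lipschitz bound allows to replace [G (t + h)] by
    [G t]. *)
Lemma quadratic_is_derive F G (c t : R) : 0 < t ->
  (forall s h : R, 0 <= s -> 0 < h -> `|F (s + h) - F s - h * G s| <= c * h ^+ 2) ->
  loc_lip G -> is_derive t 1 F (G t).
Proof.
move=> t0 FG lG; have [L hL] := lG t (ltW t0).
have c0 : 0 <= c.
  by have := FG 0 1 (lexx _) ltr01; rewrite expr1n mulr1; exact: le_trans.
have L0 : 0 <= L.
  have := hL 0 t (lexx _) (ltW t0) (lexx _); rewrite subr0 => /(le_trans (normr_ge0 _)).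
  by rewrite pmulr_lge0.
have lim : h^-1 *: ((F \o shift t) (h *: 1) - F t) @[h --> 0^'] --> G t.
  apply/cvgrPdist_le => e e0; near=> h.
  have h0 : h != 0 by near: h; exact: nbhs_dnbhs_neq.
  have ht : `|h| <= t.
    by near: h; exact: dnbhs0_le.
  have he : `|h| <= e / (c + L + 1).
    by near: h; apply: dnbhs0_le; rewrite divr_gt0// ltr_wpDl// addr_ge0.
  rewrite /= [h *: 1]mulr1 /GRing.scale /=.
  apply: (@le_trans _ _ ((c + L) * `|h|)); last first.
    rewrite (le_trans (ler_wpM2l _ he)) ?addr_ge0// mulrCA ger_pMr//.
    by rewrite ler_pdivrMr ?ltr_wpDl ?addr_ge0// mul1r lerDl.
  have -> : G t - h^-1 * (F (h + t) - F t) = - h^-1 * (F (h + t) - F t - h * G t).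
    by field.
  have h2 : `|h| * `|h| = h ^+ 2 by rewrite -normrM -expr2 ger0_norm ?sqr_ge0.
  rewrite normrM normrN normfV ler_pdivrMl ?normr_gt0//.
  have -> : `|h| * ((c + L) * `|h|) = (c + L) * (`|h| * `|h|) by ring.
  rewrite h2 mulrDl.
  case: (ltgtP h 0) h0 => // hs _; last first.
    by rewrite [h + t]addrC (le_trans (FG _ _ _ _)) ?(ltW t0)// lerDl mulr_ge0// sqr_ge0.
  have s0 : 0 <= t + h by move: ht; rewrite ltr0_norm//; lra.
  have h'0 : 0 < - h by rewrite oppr_gt0.
  have := FG _ _ s0 h'0; rewrite addrK sqrrN [h + t]addrC => E1.
  have E2 : `|h * (G t - G (t + h))| <= L * h ^+ 2.
    rewrite normrM ltr0_norm//.
    have := hL (t + h) t s0 _ (lexx _); rewrite gerDl (ltW hs) => /(_ isT).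
    have -> : t - (t + h) = - h by ring.
    move=> E; have -> : L * h ^+ 2 = - h * (L * - h) by ring.
    by rewrite ler_pM2l.
  have -> : F (t + h) - F t - h * G t =
     - (F t - F (t + h) - (- h) * G (t + h)) - h * (G t - G (t + h)) by ring.
  by rewrite (le_trans (ler_normB _ _))// normrN lerD.
apply: DeriveDef; first by apply/cvg_ex; exists (G t).
exact: cvg_lim.
Unshelve. all: by end_near. Qed.

Lemma continuous_bounded F (U : R) : 0 <= U -> continuous F ->
  exists2 B : R, 0 <= B & forall t : R, 0 <= t -> t <= U -> `|F t| <= B.
Proof.
move=> U0 cF.
have cN : {within `[0, U], continuous (fun t => `|F t|)}.
  apply: continuous_subspaceT => t; apply: continuous_comp; first exact: cF.
  exact: norm_continuous.
have [c _ hc] := EVT_max U0 cN.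
by exists `|F c| => // t t0 tU; apply: hc; rewrite in_itv /= t0 tU.
Qed.

Lemma derive_loc_lip F F' : continuous F -> continuous F' ->
  (forall t : R, 0 < t -> is_derive t 1 F (F' t)) -> loc_lip F.
Proof.
move=> cF cF' dF U U0; have [B B0 hB] := continuous_bounded U0 cF'.
exists B => a b a0 ab bU.
have dFab (x : R) : x \in `]a, b[%R -> is_derive x 1 F (F' x).
  by rewrite in_itv /= => /andP[ax _]; apply: dF; exact: le_lt_trans ax.
have [c] := MVT_segment ab dFab (continuous_subspaceT cF).
rewrite in_itv /= => /andP[ac cb] ->.
rewrite normrM [ `|b - a| ]ger0_norm ?subr_ge0// ler_wpM2r ?subr_ge0//.
by apply: hB; [exact: le_trans ac|exact: le_trans bU].
Qed.

End HalfLine.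

(** * Convolution of continuous functions *)

Section Convolution.
Variable R : realType.
Notation mu := (@lebesgue_measure R).
Implicit Types (f g h : R -> R).

Lemma continuous_itv_integrable h (a b : R) : continuous h ->
  mu.-integrable `[a, b] (EFin \o h).
Proof.
move=> ch; apply: continuous_compact_integrable; first exact: segment_compact.
exact: continuous_subspaceT.
Qed.

Lemma measure_itv_cc (a b : R) : a <= b -> fine (mu `[a, b]) = b - a.
Proof.
by rewrite le_eqVlt => /predU1P[->|ab]; rewrite lebesgue_measure_itv /= lte_fin
  ?ltxx ?subrr// ab.
Qed.

Lemma Rintegral_itv_le h c (a b : R) : a <= b -> continuous h ->
  (forall s, a <= s -> s <= b -> `|h s| <= c) ->
  `|\int[mu]_(s in `[a, b]) h s| <= c * (b - a).
Proof.
move=> ab ch hc; have ih := continuous_itv_integrable a b ch.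
rewrite (le_trans (le_normr_Rintegral _ ih))//.
rewrite -measure_itv_cc// -Rintegral_cst//; apply: le_Rintegral => //.
- apply: continuous_itv_integrable => t.
  by apply: continuous_comp; [exact: ch|exact: norm_continuous].
- exact: (continuous_itv_integrable a b (fun x => @cst_continuous _ _ c x)).
- by move=> s; rewrite /= in_itv /= => /andP[]; exact: hc.
Qed.

Lemma Rintegral_itv_split h (a b c : R) : a <= b -> b <= c -> continuous h ->
  \int[mu]_(s in `[a, c]) h s =
  \int[mu]_(s in `[a, b]) h s + \int[mu]_(s in `[b, c]) h s.
Proof.
move=> ab bc ch; have ih := continuous_itv_integrable a c ch.
have := Rintegral_itvB ih; rewrite -(Rintegral_itv_obnd_cbnd (r := b)); last first.
  apply: integrableS (continuous_itv_integrable b c ch) => //.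
  exact: subset_itv_oc_cc.
by move=> /(_ b) <-; rewrite ?bnd_simp ?subrKC.
Qed.

Lemma continuous_conv_integrand f g (u : R) : continuous f -> continuous g ->
  continuous (fun s => f (u - s) * g s).
Proof.
move=> cf cg s; apply: cvgM; last exact: cg.
apply: (@continuous_comp _ _ _ (fun s => u - s) f); last exact: cf.
by apply: cvgB; [exact: cvg_cst|exact: cvg_id].
Qed.

Lemma convolution_ext f g (u : R) : convolution f g u =
  \int[mu]_(s in `[0, u]) (ext f (u - s) * ext g s).
Proof.
apply: eq_Rintegral => s; rewrite inE /= in_itv /= => /andP[s0 su].
by rewrite !extE// subr_ge0.
Qed.

Lemma continuous_sum (I : Type) (s : seq I) (Q : pred I) (F : I -> R -> R) :
  (forall i, continuous (F i)) -> continuous (fun t => \sum_(i <- s | Q i) F i t).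
Proof.
move=> cF; elim: s => [|i s IH].
  by under eq_fun do rewrite big_nil; exact: cst_continuous.
under eq_fun do rewrite big_cons.
by case: (Q i) => // t; apply: cvgD; [exact: cF|exact: IH].
Qed.

Section FixedKernel.
Variable f : R -> R.
Hypotheses (cf : continuous (ext f)) (lf : loc_lip f).

Lemma convolution_sum (I : Type) (s : seq I) (g : I -> R -> R) u :
  (forall i, continuous (ext (g i))) ->
  convolution f (fun t => \sum_(i <- s) g i t) u = \sum_(i <- s) convolution f (g i) u.
Proof.
move=> cg.
have csum s' : continuous (ext (fun t => \sum_(i <- s') g i t)).
  by apply: (@continuous_sum _ s' xpredT (fun i => ext (g i))).
elim: s => [|i s IH].
  rewrite big_nil convolution_ext.
  under eq_Rintegral do rewrite /ext big_nil mulr0.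
  by rewrite Rintegral_cst// mul0r.
rewrite big_cons -IH !convolution_ext -RintegralD//=; last 2 first.
- by apply: continuous_itv_integrable; exact: continuous_conv_integrand.
- by apply: continuous_itv_integrable; exact: continuous_conv_integrand.
by apply: eq_Rintegral => t _; rewrite /ext big_cons mulrDr.
Qed.

Lemma convolutionB g h u : continuous (ext g) -> continuous (ext h) ->
  convolution f (fun t => g t - h t) u = convolution f g u - convolution f h u.
Proof.
move=> cg ch; rewrite !convolution_ext -RintegralB//=; last 2 first.
- by apply: continuous_itv_integrable; exact: continuous_conv_integrand.
- by apply: continuous_itv_integrable; exact: continuous_conv_integrand.
by apply: eq_Rintegral => t _; rewrite /ext mulrBr.
Qed.

(** Moving the upper end from [a] to [b] changes the kernel on [0, a], at a
    Lipschitz cost, and adds an integral over [a, b]. *)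
Lemma convolution_continuous g : continuous (ext g) -> continuous (ext (convolution f g)).
Proof.
move=> cg; apply: loc_lip_continuous => U U0.
have [L hL] := lf U0.
have [A A0 hA] := continuous_bounded U0 cf.
have [B B0 hB] := continuous_bounded U0 cg.
exists (`|L| * B * U + A * B) => a b a0 ab bU; have b0 := le_trans a0 ab.
have ci v := @continuous_conv_integrand _ _ v cf cg.
rewrite !convolution_ext (Rintegral_itv_split a0 ab (ci b)).
rewrite addrAC -RintegralB//=; last 2 first.
- exact: continuous_itv_integrable.
- exact: continuous_itv_integrable.
rewrite (le_trans (ler_normD _ _))// mulrDl lerD//; last first.
  apply: Rintegral_itv_le => // s as_ sb.
  by rewrite normrM ler_pM// ?hA ?hB// ?subr_ge0 ?(le_trans a0 as_) ?(le_trans sb)// lerBlDr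
     (le_trans bU)// lerDl (le_trans a0).
have -> : `|L| * B * U * (b - a) = `|L| * B * (b - a) * U by ring.
apply: (@le_trans _ _ (`|L| * B * (b - a) * (a - 0))); last first.
  by rewrite subr0 ler_wpM2l ?(le_trans ab)// !mulr_ge0// subr_ge0.
apply: Rintegral_itv_le => //.
  by move=> s; apply: cvgB; exact: ci.
move=> s s0 sa; rewrite -mulrBl normrM mulrAC ler_pM//; last first.
  by apply: hB => //; rewrite (le_trans sa)// (le_trans ab).
rewrite !extE ?subr_ge0 ?(le_trans sa)//.
have -> : b - a = (b - s) - (a - s) by ring.
rewrite (le_trans (hL _ _ _ _ _)) ?subr_ge0 ?lerD2r//.
  by rewrite (le_trans _ bU)// gerDl oppr_le0.
by rewrite ler_wpM2r ?ler_norm// subr_ge0 lerD2r.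
Qed.

(** Each convolution with a bounded kernel integrates the monomial once more;
    this is the source of the factorial decay of iterated convolutions. *)
Lemma convolution_monomial_le g (A B U : R) k : 0 <= A ->
  (forall t : R, 0 <= t -> t <= U -> `|f t| <= A) -> continuous (ext g) ->
  (forall t : R, 0 <= t -> t <= U -> `|g t| <= B * (t ^+ k / k`!%:R)) ->
  forall t : R, 0 <= t -> t <= U ->
    `|convolution f g t| <= A * B * (t ^+ k.+1 / k.+1`!%:R).
Proof.
move=> A0 fA cg gB t t0 tU.
have ci := @continuous_conv_integrand _ _ t cf cg.
have cm : continuous (fun s : R => A * B * (s ^+ k / k`!%:R)).
  move=> s; apply: cvgM; first exact: cvg_cst.
  by apply: cvgM; [exact: exprn_continuous|exact: cvg_cst].
rewrite convolution_ext.
rewrite (le_trans (le_normr_Rintegral _ (continuous_itv_integrable 0 t ci)))//.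
have : \int[mu]_(s in `[0, t]) (A * B * (s ^+ k / k`!%:R)) =
    A * B * (t ^+ k.+1 / k.+1`!%:R).
  pose F (s : R) := A * B * (s ^+ k.+1 / k.+1`!%:R).
  move: t0; rewrite le_eqVlt => /predU1P[<-|t0].
    by rewrite set_itv1 Rintegral_set1 expr0n /= mul0r mulr0.
  have dF (x : R) : is_derive x 1 F (A * B * (x ^+ k / k`!%:R)).
    have := is_derive_poly ((A * B / k.+1`!%:R) *: ('X ^+ k.+1)) x.
    rewrite derivZ derivXn hornerZ hornerMn hornerXn -(mulr_natr (x ^+ k)) /=.
    rewrite (_ : horner _ = F); last first.
      by apply/funext => s; rewrite /F hornerZ hornerXn mulrAC mulrA.
    rewrite (_ : A * B / _ * _ = A * B * (x ^+ k / k`!%:R))//.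
    have k0 : k`!%:R != 0 :> R by rewrite pnatr_eq0 -lt0n fact_gt0.
    have k1 : k.+1%:R != 0 :> R by rewrite pnatr_eq0.
    by rewrite factS natrM; field; rewrite k0 ?natr1 ?nat1r k1.
  rewrite /Rintegral (continuous_FTC2 t0 (continuous_subspaceT cm) (F := F)).
  - by rewrite /F /= expr0n /= mul0r mulr0 subr0.
  - have cF (x : R) : {for x, continuous F}.
      by apply: differentiable_continuous; apply/derivable1_diffP; exact: ex_derive.
    split; [by move=> x _; exact: ex_derive| |].
      by apply: cvg_at_right_filter; exact: cF.
    by apply: cvg_at_left_filter; exact: cF.
  - by move=> x _; rewrite derive1E; apply: derive_val.
move=> <-; apply: le_Rintegral => //.
- apply: continuous_itv_integrable => s.
  apply: (@continuous_comp _ _ _ (fun s => ext f (t - s) * ext g s) Num.norm).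
    exact: ci.
  exact: norm_continuous.
- exact: continuous_itv_integrable.
move=> s; rewrite /= in_itv /= => /andP[s0 st].
rewrite normrM -mulrA !extE ?subr_ge0// ler_pM//.
  by rewrite fA ?subr_ge0// (le_trans _ tU)// gerDl oppr_le0.
by rewrite gB// (le_trans st).
Qed.

End FixedKernel.

Lemma cvg_pow_fact (c : R) : (c ^+ k / k`!%:R) @[k --> \oo] --> (0 : R).
Proof. exact: (cvg_series_cvg_0 (is_cvg_series_exp_coeff c)). Qed.

End Convolution.

(** * The Neumann series of the renewal equation *)

Section RenewalSeries.
Variables (R : realType) (f H : R -> R).
Hypotheses (cf : continuous (ext f)) (lf : loc_lip f) (cH : continuous (ext H)).
Hypothesis renewal : forall u : R, 0 <= u -> H u = f u + convolution f H u.

Let cp j := iter j (convolution f) f.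
Let remainder k u := H u - \sum_(j <- iota 0 k) cp j u.

Let cp_continuous j : continuous (ext (cp j)).
Proof. by elim: j => //= j IH; exact: convolution_continuous. Qed.

Let sum_continuous k : continuous (ext (fun u => \sum_(j <- iota 0 k) cp j u)).
Proof. exact: (@continuous_sum _ _ _ xpredT (fun j => ext (cp j))). Qed.

Let remainder_continuous k : continuous (ext (remainder k)).
Proof. by move=> u; apply: cvgB; [exact: cH|exact: sum_continuous]. Qed.

(** Substituting the equation into [H] convolves the remainder once more. *)
Let remainderS k (u : R) : 0 <= u -> remainder k.+1 u = convolution f (remainder k) u.
Proof.
move=> u0; rewrite /remainder convolutionB// convolution_sum//.
rewrite renewal// -[in LHS](addn1 k) addnC iotaD big_cat big_seq1 /=.
rewrite opprD addrACA subrr add0r; congr (_ - _).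
by rewrite (iotaDl 1 0) big_map.
Qed.

Let remainder_le (A B U : R) : 0 <= A -> (forall t : R, 0 <= t -> t <= U -> `|f t| <= A) ->
  (forall t : R, 0 <= t -> t <= U -> `|H t| <= B) ->
  forall k (t : R), 0 <= t -> t <= U ->
    `|remainder k t| <= A ^+ k * B * (t ^+ k / k`!%:R).
Proof.
move=> A0 fA HB; elim=> [|k IH] t t0 tU.
  by rewrite /remainder big_nil subr0 !expr0 fact0 divr1 mul1r mulr1 HB.
rewrite remainderS// exprS -(mulrA A).
exact: (convolution_monomial_le cf A0 fA (@remainder_continuous k) IH).
Qed.

(** The [k]-th partial sum misses [H] by a [k]-fold convolution of [f] with [H],
    which [remainder_le] makes factorially small. *)
Lemma renewal_series_cvg (u : R) : 0 <= u ->
  \sum_(1 <= k < m) conv_power f k u @[m --> \oo] --> H u.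
Proof.
move=> u0.
have [A A0 hA] := continuous_bounded u0 cf.
have [B B0 hB] := continuous_bounded u0 cH.
have fA (t : R) : 0 <= t -> t <= u -> `|f t| <= A by move=> t0 /(hA t t0); rewrite extE.
have HB (t : R) : 0 <= t -> t <= u -> `|H t| <= B by move=> t0 /(hB t t0); rewrite extE.
rewrite -cvg_shiftS /=.
have partial m : \sum_(1 <= k < m.+1) conv_power f k u = H u - remainder m u.
  by rewrite /remainder subKr big_add1 /= /index_iota subn0.
under eq_fun do rewrite partial.
suff : H u - remainder m u @[m --> \oo] --> H u - 0 by rewrite subr0.
apply: cvgB; first exact: cvg_cst.
apply: norm_cvg0.
apply: (@squeeze_cvgr _ _ _ _ (fun=> 0) (fun k => B * ((A * u) ^+ k / k`!%:R))).
- near=> k; rewrite normr_ge0 (le_trans (remainder_le A0 fA HB _ _ _))// exprMn.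
  by rewrite le_eqVlt; apply/orP; left; apply/eqP; ring.
- exact: cvg_cst.
- suff : B * ((A * u) ^+ k / k`!%:R) @[k --> \oo] --> B * 0 by rewrite mulr0.
  by apply: cvgM; [exact: cvg_cst|exact: cvg_pow_fact].
Unshelve. all: by end_near. Qed.

End RenewalSeries.

(** * Duality for the discrete Laplacian *)

Section DiscreteDuality.
Variables (R : realType) (d n : nat).
Implicit Types (i j k : torus d n) (f g v : torus d n -> R).

Lemma sum_laplacian_adjoint f g :
  \sum_i laplacian f i * g i = \sum_i f i * laplacian g i.
Proof.
have E f1 g1 : \sum_i laplacian f1 i * g1 i =
    (2 * d)%:R^-1 * (\sum_i \sum_(j | neighbor i j) f1 j * g1 i) - \sum_i f1 i * g1 i.
  rewrite mulr_sumr -sumrB; apply: eq_bigr => i _.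
  by rewrite /laplacian /neighbor_mean mulrBl -mulrA mulr_suml.
rewrite E; under [RHS]eq_bigr do rewrite mulrC.
rewrite E; congr (_ * _ - _); last by apply: eq_bigr => i _; rewrite mulrC.
rewrite (exchange_big_dep xpredT)//=; apply: eq_bigr => j _.
by apply: eq_big => [i|i _]; [rewrite neighbor_sym|rewrite mulrC].
Qed.

(** Point reflections preserve the neighbour relation. *)
Lemma laplacian_reflect f i j : laplacian f (i - j) = laplacian (fun a => f (i - a)) j.
Proof.
rewrite /laplacian /neighbor_mean; congr (_ * _ - _).
rewrite (reindex_inj (inj_comp (addrI i) oppr_inj)) /=; apply: eq_bigl => k.
by rewrite ![i + _]addrC neighbor_translate neighbor_opp.
Qed.

Lemma sum_unit_mass f i : \sum_j (i == j)%:R * f j = f i.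
Proof.
rewrite (bigD1 i)//= eqxx mul1r big1 ?addr0// => j /negPf ji.
by rewrite eq_sym ji mul0r.
Qed.

Definition quadratic_form v (C : torus d n -> torus d n -> R) : R :=
  \sum_j \sum_k v j * v k * C j k.

(** The left-hand side is the derivative of [quadratic_form v C] when [v] solves
    the backward heat equation and [C] the forward one with the source [h] on the
    diagonal. By self-adjointness the two Laplacians cancel in each variable. *)
Lemma quadratic_form_rate v (C : torus d n -> torus d n -> R) (h : torus d n -> R) :
  \sum_j \sum_k ((- laplacian v j * v k + v j * - laplacian v k) * C j k +
    v j * v k * (laplacian (fun a => C a k) j + laplacian (C j) k + (j == k)%:R * h j))
  = \sum_j v j ^+ 2 * h j.
Proof.
transitivity
  (\sum_j \sum_k (v k * (v j * laplacian (fun a => C a k) j - laplacian v j * C j k))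
  + \sum_j \sum_k (v j * (v k * laplacian (C j) k - laplacian v k * C j k))
  + \sum_j \sum_k (j == k)%:R * (v j * h j * v k)).
  rewrite -!big_split /=; apply: eq_bigr => j _; rewrite -!big_split /=.
  by apply: eq_bigr => k _; ring.
rewrite exchange_big /= [X in X + _ + _]big1 ?[X in _ + X + _]big1 ?add0r.
- by apply: eq_bigr => j _; rewrite sum_unit_mass; ring.
- by move=> j _; rewrite -mulr_sumr sumrB -sum_laplacian_adjoint subrr mulr0.
- by move=> k _; rewrite -mulr_sumr sumrB -sum_laplacian_adjoint subrr mulr0.
Qed.

Lemma quadratic_form_laplacian_delta i (C : torus d n -> torus d n -> R) :
  quadratic_form (laplacian (fun a => (i == a)%:R)) C =
  laplacian (fun a => laplacian (fun b => C a b) i) i.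
Proof.
rewrite -[RHS](sum_unit_mass (laplacian (fun a => laplacian (fun b => C a b) i))).
rewrite -sum_laplacian_adjoint; apply: eq_bigr => j _.
rewrite -[in RHS](sum_unit_mass (laplacian (fun b => C j b))).
rewrite -sum_laplacian_adjoint mulr_sumr.
by apply: eq_bigr => k _; rewrite mulrA.
Qed.

End DiscreteDuality.

Section FiniteSums.
Variable R : realType.

Lemma is_derive_bigsum (I : Type) (s : seq I) (F : I -> R -> R) (dF : I -> R) (t : R) :
  (forall i, is_derive t 1 (F i) (dF i)) ->
  is_derive t 1 (fun x => \sum_(i <- s) F i x) (\sum_(i <- s) dF i).
Proof.
move=> dFi; elim: s => [|i s IH].
  by under eq_fun do rewrite big_nil; rewrite big_nil; exact: is_derive_cst.
by under eq_fun do rewrite big_cons; rewrite big_cons; exact: is_deriveD.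
Qed.

Variables d n : nat.

Lemma continuous_laplacian (F : torus d n -> R -> R) i :
  (forall j, continuous (F j)) -> continuous (fun t => laplacian (F ^~ t) i).
Proof.
move=> cF t; apply: cvgB; last exact: cF.
by apply: cvgM; [exact: cvg_cst|exact: continuous_sum].
Qed.

Lemma is_derive_laplacian (F : torus d n -> R -> R) (dF : torus d n -> R) (t : R) i :
  (forall j, is_derive t 1 (F j) (dF j)) ->
  is_derive t 1 (fun x => laplacian (F ^~ x) i) (laplacian dF i).
Proof.
move=> dFi; apply: (@is_deriveB _ _ _ (fun x => neighbor_mean (F ^~ x) i) (F i)) => //.
apply: (@is_deriveZ _ _ _ (fun x => \sum_(j | neighbor i j) F j x)).
by rewrite -big_filter; under eq_fun do rewrite -big_filter; exact: is_derive_bigsum.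
Qed.

Lemma loc_lip_laplacian (F : torus d n -> R -> R) i :
  (forall j, loc_lip (F j)) -> loc_lip (fun t => laplacian (F ^~ t) i).
Proof.
move=> lF; apply: loc_lipD; first by apply: loc_lipZ; exact: loc_lip_sum.
by under eq_fun do rewrite -mulN1r; exact: loc_lipZ.
Qed.

Lemma eq_loc_lip (F G : R -> R) : (forall t, 0 <= t -> F t = G t) -> loc_lip F -> loc_lip G.
Proof.
move=> FG lF U U0; have [L hL] := lF U U0; exists L => a b a0 ab bU.
by rewrite -!FG ?hL// (le_trans a0).
Qed.

End FiniteSums.

(** * The heat kernel *)

Section HeatKernel.
Variables (R : realType) (d n : nat) (p : R -> torus d n -> R).
Hypothesis hp : heat_kernel p.

Definition heat_laplacian (i : torus d n) (t : R) : R :=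
  laplacian (fun a => ext (p ^~ a) t) i.

Lemma heat_kernel_continuous i : continuous (ext (p ^~ i)).
Proof.
have [_ p0 dp] := hp; apply: ext_continuous; first exact: p0.
move=> t t0; apply: differentiable_continuous; apply/derivable1_diffP.
by case: (dp t i t0).
Qed.

Lemma heat_kernel_derive i (t : R) : 0 < t ->
  is_derive t 1 (ext (p ^~ i)) (heat_laplacian i t).
Proof.
have [_ _ dp] := hp => t0; apply: ext_is_derive => //.
rewrite /heat_laplacian -(eq_laplacian i (fun a => esym (extE (p ^~ a) (ltW t0)))).
exact: dp.
Qed.

Lemma heat_laplacian_continuous i : continuous (heat_laplacian i).
Proof. by apply: continuous_laplacian; exact: heat_kernel_continuous. Qed.

Lemma heat_laplacian_derive i (t : R) : 0 < t ->
  is_derive t 1 (heat_laplacian i) (laplacian (heat_laplacian ^~ t) i).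
Proof. by move=> t0; apply: is_derive_laplacian => j; exact: heat_kernel_derive. Qed.

Lemma heat_laplacian0 i j : heat_laplacian (i - j) 0 = laplacian (fun a => (i == a)%:R) j.
Proof.
have [p0 _ _] := hp; rewrite /heat_laplacian laplacian_reflect; apply: eq_laplacian => a.
by rewrite extE// p0 subr_eq0.
Qed.

Lemma ext_heat_energy :
  ext (heat_energy p) = fun t => \sum_i heat_laplacian i t * heat_laplacian i t.
Proof. by apply/funext => t; apply: eq_bigr => i _; rewrite expr2. Qed.

Lemma heat_energy_continuous : continuous (ext (heat_energy p)).
Proof.
rewrite ext_heat_energy; apply: continuous_sum => i t.
by apply: cvgM; exact: heat_laplacian_continuous.
Qed.

(** The energy is differentiable at positive times only, with a derivative that
    extends continuously to [0]: the mean value theorem applies up to [0]. *)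
Lemma heat_energy_loc_lip : loc_lip (heat_energy p).
Proof.
apply: (@eq_loc_lip _ (ext (heat_energy p))); first exact: extE.
pose L i t := laplacian (heat_laplacian ^~ t) i.
apply: (@derive_loc_lip _ _
  (fun t => \sum_i (heat_laplacian i t * L i t + heat_laplacian i t * L i t))).
- exact: heat_energy_continuous.
- apply: continuous_sum => i t.
  have cq := @heat_laplacian_continuous.
  have cL : continuous (L i) by apply: continuous_laplacian; exact: cq.
  by apply: cvgD; apply: cvgM; [exact: cq|exact: cL|exact: cq|exact: cL].
move=> t t0; rewrite ext_heat_energy; apply: is_derive_bigsum => i.
by apply: is_deriveM; exact: heat_laplacian_derive.
Qed.

Lemma is_derive_reflect (F : R -> R) (u s D : R) :
  is_derive (u - s) 1 F D -> is_derive s 1 (fun x => F (u - x)) (- D).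
Proof.
move=> dF; have du : is_derive s 1 (fun x : R => u - x) (-1).
  by rewrite -[-1]add0r; apply: is_deriveB.
have := @is_derive1_comp _ F (fun x => u - x) s D (-1) dF du.
by rewrite mulrN1.
Qed.

End HeatKernel.

(** * Regularity of the second moments *)

Section MomentRegularity.
Variables (R : realType) (disp : measure_display) (T : measurableType disp).
Variables (P : probability T R) (d n : nat).
Variables (N : torus d n -> R -> {RV P >-> nat}) (Y : R -> torus d n -> {RV P >-> R}).
Hypothesis hY : smoothing_process N Y.
Hypothesis hY0 : {ae P, forall w, forall i, Y 0 i w = (i == 0)%:R}.

Let C i j t := pair_moment Y t i j.

Lemma pair_moment_loc_lip i j : loc_lip (C i j).
Proof.
set c : R := 2 * #|{: torus d n}|%:R ^+ 2 + 3 * #|{: torus d n}|%:R.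
have c0 : 0 <= c by rewrite addr_ge0 ?mulr_ge0 ?sqr_ge0.
move=> U U0; exists (c * U + 3) => a b a0; rewrite le_eqVlt => /predU1P[->|ab] bU.
  by rewrite !subrr normr0 mulr0.
have h0 : 0 < b - a by rewrite subr_gt0.
have := pair_moment_expansion hY hY0 i j a0 h0; rewrite subrKC -/c => E.
have D3 := mean_cube_le hY hY0 (@borel_pair_generator R _ T d n i j)
  (fun y => @pair_generator_le R d n i j y) a0.
have -> : C i j b - C i j a = (C i j b - C i j a - (b - a) * moment_rate Y a i j)
  + (b - a) * moment_rate Y a i j by rewrite subrK.
rewrite (le_trans (ler_normD _ _))// [leRHS]mulrDl lerD//.
  rewrite (le_trans E)// expr2 mulrA -mulrA -[leRHS]mulrA ler_wpM2l//.
  rewrite ler_wpM2r ?(ltW h0)// (le_trans _ bU)// gerDl oppr_le0//.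
by rewrite normrM gtr0_norm// mulrC ler_pM2r.
Qed.

Lemma laplacian_sq_moment_loc_lip i : loc_lip (fun t => laplacian_sq_moment Y t i).
Proof.
apply: (@eq_loc_lip _ (fun t => laplacian (fun a => laplacian (fun b => C a b t) i) i)).
  by move=> t t0; rewrite (laplacian_sq_momentE hY hY0).
apply: loc_lip_laplacian => a; apply: loc_lip_laplacian => b.
exact: pair_moment_loc_lip.
Qed.

Lemma moment_rate_loc_lip i j : loc_lip (fun t => moment_rate Y t i j).
Proof.
apply: (@eq_loc_lip _ (fun t => laplacian (fun a => C a j t) i +
   laplacian (fun b => C i b t) j + (i == j)%:R * laplacian_sq_moment Y t i)).
  by move=> t t0; rewrite (moment_rateE hY hY0).
apply: loc_lipD; last by apply: loc_lipZ; exact: laplacian_sq_moment_loc_lip.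
apply: loc_lipD; apply: loc_lip_laplacian => a; exact: pair_moment_loc_lip.
Qed.

Lemma pair_moment_derive i j (t : R) : 0 < t ->
  is_derive t 1 (ext (C i j)) (moment_rate Y t i j).
Proof.
move=> t0; apply: ext_is_derive => //.
apply: quadratic_is_derive t0 _ (moment_rate_loc_lip i j) => s h s0 h0.
exact: (pair_moment_expansion hY hY0 i j s0 h0).
Qed.

Lemma pair_moment0 i j : pair_moment Y 0 i j = (i == 0)%:R * (j == 0)%:R.
Proof.
rewrite -[RHS](mean_cst P); apply: ae_eq_mean.
- exact: (as_bounded_pair hY hY0).
- exact: as_bounded_cst.
- by apply: filterS hY0 => x Y0; rewrite !Y0.
Qed.

End MomentRegularity.

(** * Duhamel's formula and the renewal equation *)

Section Renewal.
Variables (R : realType) (disp : measure_display) (T : measurableType disp).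
Variables (P : probability T R) (d n : nat).
Variables (N : torus d n -> R -> {RV P >-> nat}) (Y : R -> torus d n -> {RV P >-> R}).
Hypothesis hY : smoothing_process N Y.
Hypothesis hY0 : {ae P, forall w, forall i, Y 0 i w = (i == 0)%:R}.
Variable p : R -> torus d n -> R.
Hypothesis hp : heat_kernel p.

Definition laplacian_energy t := \sum_i laplacian_sq_moment Y t i.

Let C i j t := pair_moment Y t i j.

Section Duhamel.
Variable u : R.
Hypothesis u0 : 0 <= u.

Let v i s j := heat_laplacian p (i - j) (u - s).

(** Let the heat flow act for the time [u - s] on the configuration of time [s]:
    this is the expected sum of the squares of the Laplacian of the result. *)
Definition duhamel_energy s :=
  \sum_i quadratic_form (v i s) (fun j k => ext (C j k) s).

Let v_continuous i j : continuous (fun s => v i s j).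
Proof.
move=> s; apply: (@continuous_comp _ _ _ (fun s => u - s)); last first.
  exact: heat_laplacian_continuous.
by apply: cvgB; [exact: cvg_cst|exact: cvg_id].
Qed.

Lemma duhamel_energy_continuous : continuous duhamel_energy.
Proof.
apply: continuous_sum => i; apply: continuous_sum => j; apply: continuous_sum => k s.
apply: cvgM; first by apply: cvgM; exact: v_continuous.
exact: (loc_lip_continuous (pair_moment_loc_lip hY hY0 j k)).
Qed.

(** The term of [i] follows [quadratic_form_rate], for the kernel seen from [i]
    and run backward in [s]. As [i] varies, the kernels seen from a site run over
    all translates, so each site contributes the whole [heat_energy]. *)
Lemma duhamel_energy_derive (s : R) : 0 < s -> s < u ->
  is_derive s 1 duhamel_energy (heat_energy p (u - s) * laplacian_energy s).
Proof.
move=> s0 su.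
have vE i j : laplacian (heat_laplacian p ^~ (u - s)) (i - j) = laplacian (v i s) j.
  exact: laplacian_reflect.
have dv i j : is_derive s 1 (fun x => v i x j) (- laplacian (v i s) j).
  rewrite -vE; apply: is_derive_reflect.
  by apply: heat_laplacian_derive => //; rewrite subr_gt0.
have -> : heat_energy p (u - s) * laplacian_energy s =
    \sum_i \sum_j v i s j ^+ 2 * laplacian_sq_moment Y s j.
  rewrite exchange_big /= mulr_sumr; apply: eq_bigr => j _.
  rewrite -mulr_suml; congr (_ * _).
  rewrite [RHS](reindex_inj (addIr j)) /=; apply: eq_bigr => i _.
  rewrite /v addrK /heat_laplacian; congr (_ ^+ 2); apply: eq_laplacian => a.
  by rewrite extE// subr_ge0 ltW//.
apply: is_derive_bigsum => i.
rewrite -(quadratic_form_rate _ (fun j k => C j k s)).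
apply: is_derive_bigsum => j; apply: is_derive_bigsum => k.
have -> : laplacian (fun a => C a k s) j + laplacian (C j ^~ s) k +
  (j == k)%:R * laplacian_sq_moment Y s j = moment_rate Y s j k.
  by rewrite (moment_rateE hY hY0) ?ltW.
have d1 := is_deriveM (dv i j) (dv i k).
have d2 := is_deriveM d1 (pair_moment_derive hY hY0 j k s0).
apply: (is_derive_eq d2); rewrite /GRing.scale /= extE ?ltW// -/(C j k s).
rewrite /= (_ : (_ * _) s = v i s j * v i s k)//; ring.
Qed.

Lemma duhamel_energy_end : duhamel_energy u = laplacian_energy u.
Proof.
apply: eq_bigr => i _; rewrite (laplacian_sq_momentE hY hY0)// -quadratic_form_laplacian_delta.
apply: eq_bigr => j _; apply: eq_bigr => k _.
by rewrite /v subrr !(heat_laplacian0 hp) extE.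
Qed.

Lemma duhamel_energy_start : duhamel_energy 0 = heat_energy p u.
Proof.
apply: eq_bigr => i _; rewrite /quadratic_form.
under eq_bigr => j _.
  under eq_bigr => k _.
    rewrite extE// /C (pair_moment0 hY hY0).
    rewrite (_ : _ * _ = (0 == k)%:R * ((0 == j)%:R * (v i 0 j * v i 0 k))); last first.
      by rewrite (eq_sym 0 k) (eq_sym 0 j); ring.
    over.
  rewrite sum_unit_mass.
  over.
rewrite sum_unit_mass /v !subr0 -expr2; congr (_ ^+ 2).
by apply: eq_laplacian => a; rewrite extE.
Qed.

End Duhamel.

Lemma laplacian_energy_loc_lip : loc_lip laplacian_energy.
Proof. by apply: loc_lip_sum => i; exact: (laplacian_sq_moment_loc_lip hY hY0). Qed.

Lemma laplacian_energy_renewal (u : R) : 0 <= u ->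
  laplacian_energy u = heat_energy p u + convolution (heat_energy p) laplacian_energy u.
Proof.
move=> u0; move: (u0); rewrite le_eqVlt => /predU1P[<-|u_gt0].
  rewrite /convolution set_itv1 Rintegral_set1 addr0.
  by rewrite -(duhamel_energy_end (lexx 0)) (duhamel_energy_start (lexx 0)).
rewrite -duhamel_energy_end// -duhamel_energy_start// convolution_ext.
have cg := loc_lip_continuous laplacian_energy_loc_lip.
have cf := heat_energy_continuous hp.
have ci := @continuous_conv_integrand _ _ _ u cf cg.
have cD := @duhamel_energy_continuous u.
have dD (s : R) : s \in `]0, u[ -> is_derive s 1 (duhamel_energy u)
    (ext (heat_energy p) (u - s) * ext laplacian_energy s).
  rewrite in_itv /= => /andP[s0 su]; rewrite !extE ?ltW ?subr_gt0//.
  exact: duhamel_energy_derive.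
rewrite /Rintegral (continuous_FTC2 u_gt0 (continuous_subspaceT ci) (F := duhamel_energy u)).
- by rewrite /= subrKC.
- split; first by move=> s /dD[].
    by apply: cvg_at_right_filter; exact: cD.
  by apply: cvg_at_left_filter; exact: cD.
- by move=> s /dD[_]; rewrite derive1E.
Qed.

Lemma expectation_laplacian_energy u : 0 <= u ->
  ('E_P[fun w => (\sum_i laplacian (fun j => Y u j w) i ^+ 2)%R] =
   (laplacian_energy u)%:E)%E.
Proof.
move=> u0; have bL i : as_bounded P (fun x => laplacian (fun j => Y u j x) i ^+ 2).
  apply: (as_bounded_statistic hY hY0 (f := fun y => laplacian y i ^+ 2) (K := 1)) => //.
    move=> X mX; under eq_fun do rewrite expr2.
    by apply: measurable_funM; exact: borel_laplacian.
  by move=> y y01; rewrite normrX exprn_ile1// laplacian_cube_le.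
rewrite as_bounded_expectation; last exact: as_bounded_sum.
by rewrite mean_sum.
Qed.

End Renewal.

Theorem lemma5p2 (R : realType) (disp : measure_display)
    (T : measurableType disp) (P : probability T R)
    (d n : nat) (hd : (1 <= d)%N) (hn : (3 <= n)%N) (hodd : odd n)
    (N : torus d n -> R -> {RV P >-> nat})
    (Y : R -> torus d n -> {RV P >-> R})
    (hY : smoothing_process N Y)
    (hY0 : {ae P, forall w, forall i, Y 0 i w = (i == 0)%:R})
    (p : R -> torus d n -> R) (hp : heat_kernel p)
    (u : R) (hu : 0 <= u) :
  ('E_P[fun w => (\sum_i laplacian (fun j => Y u j w) i ^+ 2)%R] =
   \sum_(1 <= k <oo) (conv_power (heat_energy p) k u)%:E)%E.
Proof.
rewrite (expectation_laplacian_energy hY hY0 hu); apply/esym/cvg_lim => //.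
under eq_fun do rewrite sumEFin.
apply: cvg_EFin; first exact: nearW.
have cH := loc_lip_continuous (laplacian_energy_loc_lip hY hY0).
exact: (renewal_series_cvg (heat_energy_continuous hp) (heat_energy_loc_lip hp) cH
  (laplacian_energy_renewal hY hY0 hp) hu).
Qed.
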